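(* There is a constant $0<c\le1$, depending only on the algebraic structure of $G$, with the following property. If $\xi_1,\xi_2\in\widehat G$, $u_1\in\mathcal M_{\xi_1}$ and $u_2\in\mathcal M_{\xi_2}$, then the product $u_1u_2$ belongs to $\bigoplus_\xi\mathcal M_\xi$, where the sum ranges over those $\xi\in\widehat G$ with $$c\,\big||\xi_1|-|\xi_2|\big|\le|\xi|\le|\xi_1|+|\xi_2|.$$
   Context: $G$ is a simply connected compact semisimple Lie group equipped with the bi-invariant Riemannian metric given by the negative of the Killing form, with Laplacian $\Delta$. $\widehat G$ is the set of equivalence classes of irreducible unitary representations of $G$. For $\xi\in\widehat G$, $\mathcal M_\xi\subset L^2(G)$ is the span of the matrix entries of $\xi$; it is contained in an eigenspace of $-\Delta$ with eigenvalue $\lambda_\xi\ge0$, and $|\xi|:=\sqrt{\lambda_\xi}$. (In terms of highest weights: $\lambda_\xi=|\boldsymbol J(\xi)+\boldsymbol\varpi|^2-|\boldsymbol\varpi|^2$ with $\boldsymbol J(\xi)$ the highest weight of $\xi$ and $\boldsymbol\varpi$ the sum of the fundamental weights.) *)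

(* Defs.v *)
From HB Require Import structures.
From mathcomp Require Import all_boot all_order all_algebra.
From mathcomp Require Import spectral.
From mathcomp Require Import complex.
From mathcomp Require Import all_classical all_reals all_analysis.

Set Implicit Arguments.
Unset Strict Implicit.
Unset Printing Implicit Defensive.

Import Order.TTheory GRing.Theory Num.Theory.
Import numFieldNormedType.Exports.

Local Open Scope classical_set_scope.
Local Open Scope ring_scope.

(* [Ck k U f]: f is k times continuously differentiable on the open set U, in
   the sense of iterated Frechet differentials. It is meant for
   finite-dimensional V, where continuity of x |-> 'd f x v for each v is the
   same as continuity of the differential. *)
Fixpoint Ck (R : realType) (V W : normedModType R) (k : nat) (U : set V)
    (f : V -> W) : Prop :=
  match k with
  | 0 => forall x, U x -> {for x, continuous f}
  | k'.+1 => (forall x, U x -> differentiable f x) /\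
             forall v : V, Ck k' U (fun x => 'd f x v)
  end.

Definition smooth_on (R : realType) (V W : normedModType R) (U : set V)
    (f : V -> W) : Prop := forall k, Ck k U f.

Record chart (R : realType) (n : nat) (M : topologicalType) := Chart {
  cdom : set M;
  cfun : M -> 'rV[R]_n;
  cinv : 'rV[R]_n -> M;
  cdom_open : open cdom;
  cimg_open : open (cfun @` cdom);
  cfunK : forall x, cdom x -> cinv (cfun x) = x;
  cfun_continuous : forall x, cdom x -> {for x, continuous cfun};
  cinv_continuous : forall v, (cfun @` cdom) v -> {for v, continuous cinv}
}.

Definition cimg (R : realType) (n : nat) (M : topologicalType)
  (phi : chart R n M) : set 'rV[R]_n := cfun phi @` cdom phi.

HB.mixin Record isLieGroup (R : realType) (n : nat) G
    of Group G & Topological G := {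
  lie_atlas : set (chart R n G);
  lie_hausdorff : hausdorff_space G;
  lie_second_countable : @second_countable G;
  lie_atlas_cover : forall x : G, exists2 phi, lie_atlas phi & cdom phi x;
  lie_atlas_compat : forall phi psi, lie_atlas phi -> lie_atlas psi ->
    smooth_on [set v | cimg phi v /\ cdom psi (cinv phi v)]
              (fun v => cfun psi (cinv phi v));
  mulg_continuous : continuous (fun p : G * G => (p.1 * p.2)%g);
  invg_continuous : continuous (fun x : G => (x^-1)%g);
  mulg_smooth : forall phi chi psi,
    lie_atlas phi -> lie_atlas chi -> lie_atlas psi ->
    smooth_on [set v : 'rV[R]_n * 'rV[R]_n | [/\ cimg phi v.1, cimg chi v.2 &
                     cdom psi (cinv phi v.1 * cinv chi v.2)%g]]
              (fun v => cfun psi (cinv phi v.1 * cinv chi v.2)%g);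
  invg_smooth : forall phi psi, lie_atlas phi -> lie_atlas psi ->
    smooth_on [set v | cimg phi v /\ cdom psi ((cinv phi v)^-1)%g]
              (fun v => cfun psi ((cinv phi v)^-1)%g)
}.

#[short(type="lieGroupType")]
HB.structure Definition LieGroup (R : realType) (n : nat) :=
  {G of isLieGroup R n G & Group G & Topological G}.

Definition simply_connected (R : realType) (T : topologicalType) : Prop :=
  (forall x y : T, exists2 p : R -> T, {within `[0, 1], continuous p} &
     p 0 = x /\ p 1 = y) /\
  (forall (p : R -> T) (x : T), {within `[0, 1], continuous p} ->
     p 0 = x -> p 1 = x ->
     exists H : R * R -> T,
       [/\ {within `[0, 1] `*` `[0, 1], continuous H},
           forall t, t \in `[0, 1] -> H (0, t) = p t,
           forall t, t \in `[0, 1] -> H (1, t) = x &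
           forall s, s \in `[0, 1] -> H (s, 0) = x /\ H (s, 1) = x]).

Section LieAlgebra.
Variables (R : realType) (n : nat) (G : lieGroupType R n).

Definition smooth (f : G -> R^o) : Prop :=
  forall phi, @lie_atlas R n G phi -> smooth_on (cimg phi) (f \o cinv phi).

(* Operators on functions; only their values on smooth functions matter. *)
Definition oper : Type := (G -> R^o) -> (G -> R^o).

(* Smooth vector fields, as derivations of the algebra of smooth functions.
   Setting them to 0 on non-smooth functions makes Leibniz equality of
   operators the equality of vector fields. *)
Definition vector_field (X : oper) : Prop :=
  [/\ forall f, smooth f -> smooth (X f),
      forall f, ~ smooth f -> X f = 0,
      forall (a : R) f h, smooth f -> smooth h ->
        X (a *: f + h) = a *: X f + X h &
      forall f h, smooth f -> smooth h ->
        X (f \* h) = (X f \* h) + (f \* X h)].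

Definition left_invariant (X : oper) : Prop :=
  forall (g : G) f, smooth f ->
    X (fun x => f (g * x)%g) = (fun x => X f (g * x)%g).

Definition lie_algebra : set oper :=
  [set X | vector_field X /\ left_invariant X].

Definition lie_bracket (X Y : oper) : oper := fun f => X (Y f) - Y (X f).

Definition ideal (I : set oper) : Prop :=
  [/\ I `<=` lie_algebra, I 0,
      forall (a : R) X Y, I X -> I Y -> I (a *: X + Y) &
      forall X Y, lie_algebra X -> I Y -> I (lie_bracket X Y)].

Definition semisimple : Prop :=
  forall I, ideal I -> (forall X Y, I X -> I Y -> lie_bracket X Y = 0) ->
    I = [set 0].

Definition lie_basis (m : nat) (b : 'I_m -> oper) : Prop :=
  (forall i, lie_algebra (b i)) /\
  forall X, lie_algebra X ->
    exists! a : 'rV[R]_m, X = \sum_i a 0 i *: b i.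

Definition is_trace (T : oper -> oper) (t : R) : Prop :=
  exists m (b : 'I_m -> oper) (A : 'M[R]_m),
    [/\ lie_basis b, forall i, T (b i) = \sum_j A i j *: b j & t = \tr A].

Definition is_killing (X Y : oper) (t : R) : Prop :=
  is_trace (fun Z => lie_bracket X (lie_bracket Y Z)) t.

(* An inner product on the Lie algebra, that is, a left-invariant Riemannian
   metric on G. *)
Definition left_invariant_metric (q : oper -> oper -> R) : Prop :=
  [/\ forall X Y, lie_algebra X -> lie_algebra Y -> q X Y = q Y X,
      forall (a : R) X Y Z, lie_algebra X -> lie_algebra Y -> lie_algebra Z ->
        q (a *: X + Y) Z = a * q X Z + q Y Z &
      forall X, lie_algebra X -> X <> 0 -> 0 < q X X].

Definition neg_killing_metric (q : oper -> oper -> R) : Prop :=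
  left_invariant_metric q /\
  forall X Y, lie_algebra X -> lie_algebra Y -> is_killing X Y (- q X Y).

(* The Levi-Civita connection of a left-invariant metric, restricted to
   left-invariant fields. It preserves them by uniqueness, and since inner
   products of such fields are constant, compatibility with the metric reads
   0 = q (nab X Y) Z + q Y (nab X Z). *)
Definition levi_civita (q : oper -> oper -> R) (nab : oper -> oper -> oper) :
    Prop :=
  [/\ forall X Y, lie_algebra X -> lie_algebra Y -> lie_algebra (nab X Y),
      forall (a : R) X Y Z, lie_algebra X -> lie_algebra Y -> lie_algebra Z ->
        nab (a *: X + Y) Z = a *: nab X Z + nab Y Z /\
        nab Z (a *: X + Y) = a *: nab Z X + nab Z Y,
      forall X Y, lie_algebra X -> lie_algebra Y ->
        nab X Y - nab Y X = lie_bracket X Y &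
      forall X Y Z, lie_algebra X -> lie_algebra Y -> lie_algebra Z ->
        q (nab X Y) Z + q Y (nab X Z) = 0].

(* The Laplace-Beltrami operator, trace of the covariant Hessian
   (X, Y) |-> X (Y f) - (nab X Y) f, computed in a global orthonormal frame of
   left-invariant fields. *)
Definition laplace_beltrami (q : oper -> oper -> R) (L : oper) : Prop :=
  exists nab m (E : 'I_m -> oper),
    [/\ levi_civita q nab, lie_basis E,
        forall i j, q (E i) (E j) = (i == j)%:R &
        forall f, smooth f ->
          L f = \sum_i (E i (E i f) - nab (E i) (E i) f)].

(* Finite-dimensional, which is no restriction since G is used only when
   compact. As usual in this library rho acts on row vectors. *)
Record unitary_irrep := UnitaryIrrep {
  rdim : nat;
  rmap :> G -> 'M[R[i]]_rdim;
  rdim_gt0 : (0 < rdim)%N;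
  rmap1 : rmap 1%g = 1%:M;
  rmapM : forall x y, rmap (x * y)%g = rmap x *m rmap y;
  rmap_unitary : forall x, rmap x \is unitarymx;
  rmap_continuous : forall i j,
    continuous (fun x => complex.Re (rmap x i j) : R^o) /\
    continuous (fun x => complex.Im (rmap x i j) : R^o);
  rmap_irreducible : forall U : 'M[R[i]]_rdim,
    (forall x, stablemx U (rmap x)) -> U = 0 \/ row_full U
}.

(* Equivalent representations have the same matrix coefficients, so families
   of these spaces indexed by classes may be indexed by representatives. *)
Definition matrix_coefs (xi : unitary_irrep) : set (G -> R[i]) :=
  [set u | exists A : 'M[R[i]]_(rdim xi),
     u = fun x => \sum_i \sum_j A i j * xi x i j].

Definition eigenfunction (L : oper) (lam : R) (u : G -> R[i]) : Prop :=
  let re : G -> R^o := fun x => complex.Re (u x) in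
  let im : G -> R^o := fun x => complex.Im (u x) in
  [/\ smooth re, smooth im, - L re = lam *: re & - L im = lam *: im].

(* [rep_norm L xi r]: r is the square root of the eigenvalue of - L on the
   matrix coefficients of xi. As these do not all vanish, r is unique. *)
Definition rep_norm (L : oper) (xi : unitary_irrep) (r : R) : Prop :=
  exists2 lam : R, 0 <= lam /\ matrix_coefs xi `<=` eigenfunction L lam &
    r = Num.sqrt lam.

Definition sum_matrix_coefs (S : set unitary_irrep) : set (G -> R[i]) :=
  [set u | exists m (xi : 'I_m -> unitary_irrep) (w : 'I_m -> G -> R[i]),
     (forall k, S (xi k) /\ matrix_coefs (xi k) (w k)) /\
     u = fun x => \sum_k w k x].

End LieAlgebra.

Definition lie_algebra_isomorphic (R : realType) (n : nat)
    (G H : lieGroupType R n) : Prop :=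
  exists F : oper G -> oper H,
    [/\ set_bij (@lie_algebra R n G) (@lie_algebra R n H) F,
        forall (a : R) X Y, lie_algebra X -> lie_algebra Y ->
          F (a *: X + Y) = a *: F X + F Y &
        forall X Y, lie_algebra X -> lie_algebra Y ->
          F (lie_bracket X Y) = lie_bracket (F X) (F Y)].

(* Main.v *)
(* With c = 1 the bounds are the triangle inequality. In a frame (E_i) of
   left-invariant fields orthonormal for the negative Killing form the covariant
   derivatives nab_{E_i} E_i vanish, so the Laplacian is sum_i E_i E_i, and on
   the coefficients of a representation rho it acts through the Casimir matrix
   sum_i D_i^2 with D_i = d rho(E_i) skew-Hermitian. The adjoint action
   preserves the Killing form, so the Casimir matrix commutes with rho and is
   the scalar - |xi|^2 when rho = xi is irreducible. If xi is a constituent of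
   the tensor product of xi1 and xi2, and w is a unit vector of its space, then
   |xi|, |xi1| and |xi2| are the norms of the families (w (A_i + B_i))_i,
   (w A_i)_i and (w B_i)_i, where A_i = d xi1(E_i) (x) 1 and
   B_i = 1 (x) d xi2(E_i); hence | |xi1| - |xi2| | <= |xi| <= |xi1| + |xi2|. *)
From HB Require Import structures.
Require Import Defs.
From mathcomp Require Import all_boot all_order all_algebra.
From mathcomp Require Import spectral mxtens complex ring lra.
From mathcomp Require Import all_classical all_reals all_analysis.

Set Implicit Arguments.
Unset Strict Implicit.
Unset Printing Implicit Defensive.

Import Order.TTheory GRing.Theory Num.Theory.
Import numFieldNormedType.Exports.

Local Open Scope classical_set_scope.
Local Open Scope ring_scope.
Local Open Scope sesquilinear_scope.

(** * Unitary families of matrices *)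

Section UnitaryDecomposition.
Variable C : numClosedFieldType.

Lemma trmxC_mul m n p (A : 'M[C]_(m, n)) (B : 'M[C]_(n, p)) :
  (A *m B)^t* = B^t* *m A^t*.
Proof. by rewrite trmx_mul map_mxM. Qed.

(** Stability reads [B *m A = X *m B], and [B *m B^t* = 1] identifies [X] as the compression
    [B *m A *m B^t*]. *)
Lemma unitarymx_stable (r n : nat) (B : 'M[C]_(r, n)) (A : 'M[C]_n) :
  B \is unitarymx -> stablemx B A -> B *m A = B *m A *m B^t* *m B.
Proof. by move=> uB /submxP[X ->]; rewrite mulmxtVK. Qed.

Definition irreducible_family (T : Type) n (rho : T -> 'M[C]_n) : Prop :=
  forall U : 'M[C]_n, (forall x, stablemx U (rho x)) -> U = 0 \/ row_full U.

(** The rows of [B] form an orthonormal basis of a nonzero irreducible invariant subspace; in this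
    basis the family acts by the compressions [B *m rho x *m B^t*]. *)
Definition irreducible_block (T : Type) n (rho : T -> 'M[C]_n) d
    (B : 'M[C]_(d, n)) : Prop :=
  [/\ (0 < d)%N, B \is unitarymx, forall x, stablemx B (rho x) &
      irreducible_family (fun x => B *m rho x *m B^t*)].

Lemma irreducible_block_comp (T : Type) n r d (rho : T -> 'M[C]_n)
    (B : 'M[C]_(r, n)) (D : 'M[C]_(d, r)) :
  B \is unitarymx -> (forall x, stablemx B (rho x)) ->
  irreducible_block (fun x => B *m rho x *m B^t*) D ->
  irreducible_block rho (D *m B).
Proof.
move=> uB sB [d0 uD sD iD]; split=> //.
- exact: mul_unitarymx.
- move=> x; rewrite -mulmxA (unitarymx_stable uB (sB x)) !mulmxA.
  by have := submxMr B (sD x); rewrite !mulmxA.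
- move=> U sU; apply: iD => x; have := sU x.
  by rewrite trmxC_mul !mulmxA.
Qed.

(** For a row [v] orthogonal to [U], the product of [v *m rho x] with a row [u] of [U] is that of
    [v] with [u *m (rho x)^t*]. The adjoint again lies in the family, so the latter row stays in
    [U]. *)
Lemma stablemx_ortho (T : Type) n (rho : T -> 'M[C]_n) r s
    (U : 'M[C]_(r, n)) (V : 'M[C]_(s, n)) :
  (forall x, exists y, rho y = (rho x)^t*) ->
  (forall x, stablemx U (rho x)) ->
  (V :=: orthomx Num.conj (mx_of_hermitian (hermitian1mx _)) U)%MS ->
  forall x, stablemx V (rho x).
Proof.
move=> rhoC sU VE x; rewrite VE orthomx1E.
have [y rhoy] := rhoC x; have /submxP[X UX] := sU y.
have VU0 : V *m U^t* = 0 by apply/eqP; rewrite -orthomx1E VE.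
have -> : rho x = (rho y)^t* by rewrite rhoy trmxCK.
by rewrite -mulmxA -trmxC_mul UX trmxC_mul mulmxA VU0 mul0mx.
Qed.

(** Complete reducibility, by strong induction on the dimension: a proper nonzero stable subspace
    splits off together with its orthogonal complement. The identity is resolved into the
    projections [B^t* *m B], the form in which a matrix coefficient splits into coefficients of the
    constituents. *)
Lemma unitary_decomposition (T : Type) n (rho : T -> 'M[C]_n) :
  (forall x, exists y, rho y = (rho x)^t*) ->
  exists s : seq {d : nat & 'M[C]_(d, n)},
    {in s, forall B, irreducible_block rho (tagged B)} /\
    \sum_(B <- s) (tagged B)^t* *m tagged B = 1%:M.
Proof.
have [k] := ubnP n; elim: k n rho => // k IH n rho; rewrite ltnS => nk rhoC.
have [n0|n_gt0] := posnP n.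
  exists [::]; split=> [B|]; first by rewrite in_nil.
  by rewrite big_nil; subst n; rewrite [RHS]flatmx0.
have [irr|/existsNP[U /not_implyP[sU /not_orP[/eqP U0 Ufull]]]] :=
    EM (irreducible_family rho).
  have uE : (1%:M : 'M[C]_n)^t* = 1%:M by rewrite trmx1 map_mx1.
  exists [:: Tagged (fun d => 'M[C]_(d, n)) 1%:M]; split; last first.
    by rewrite big_seq1 /= uE mulmx1.
  move=> B; rewrite inE => /eqP -> /=; split=> //.
  - by apply/unitarymxP; rewrite uE mulmx1.
  - by move=> x; exact: submx1.
  - by move=> V sV; apply: irr => x; have := sV x; rewrite uE mul1mx mulmx1.
pose U' := orthomx Num.conj (mx_of_hermitian (hermitian1mx _)) U.
pose B1 := schmidt (row_base U); pose B2 := schmidt (row_base U').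
have rU : (\rank U < n)%N by rewrite ltn_neqAle rank_leq_col andbT; exact/negP.
have rU' : (\rank U' < n)%N.
  by rewrite rank_ortho ltn_subrL lt0n mxrank_eq0 U0.
have uB1 : B1 \is unitarymx by rewrite schmidt_unitarymx ?rank_leq_col.
have uB2 : B2 \is unitarymx by rewrite schmidt_unitarymx ?rank_leq_col.
have B1E : (B1 :=: U)%MS.
  exact: eqmx_trans (eqmx_schmidt_free (row_base_free _)) (eq_row_base _).
have B2E : (B2 :=: U')%MS.
  exact: eqmx_trans (eqmx_schmidt_free (row_base_free _)) (eq_row_base _).
have sB1 x : stablemx B1 (rho x) by rewrite (eqmx_stable _ B1E) sU.
have sB2 : forall x, stablemx B2 (rho x) by exact: stablemx_ortho rhoC sU B2E.
have B12 : B1^t* *m B1 + B2^t* *m B2 = 1%:M.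
  (* The number of rows of [M] is a sum of two ranks, not syntactically [n], so [M^t* *m M = 1] is
     not read off from squareness. It follows from a left inverse [X] of [M], which exists because
     the two subspaces span everything. *)
  pose M := col_mx B1 B2.
  have uM : M *m M^t* = 1%:M.
    by apply/unitarymxP; exact: schmidt_complete_unitarymx.
  have /submxP[X XM] : (1%:M <= M)%MS.
    by rewrite -addsmxE (adds_eqmx B1E B2E) (addsmx_ortho U).
  have : M^t* *m M = 1%:M.
    by rewrite -[M^t*]mul1mx XM -(mulmxA X) uM mulmx1.
  by rewrite tr_col_mx map_row_mx mul_row_col.
(* The induction hypothesis decomposes the compression to the span of [B]; composing its blocks with
   [B] brings them back to the whole space, where they sum to the projection onto that span. *)
have part r (B : 'M[C]_(r, n)) : (r < n)%N -> B \is unitarymx ->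
    (forall x, stablemx B (rho x)) ->
    exists s : seq {d : nat & 'M[C]_(d, n)},
      {in s, forall B, irreducible_block rho (tagged B)} /\
      \sum_(D <- s) (tagged D)^t* *m tagged D = B^t* *m B.
  move=> rn uB sB.
  have [] := IH r (fun x => B *m rho x *m B^t*).
  - exact: leq_trans rn nk.
  - move=> x; have [y rhoy] := rhoC x; exists y.
    by rewrite !trmxC_mul trmxCK rhoy mulmxA.
  move=> s [sP s1].
  exists [seq Tagged (fun d => 'M[C]_(d, n)) (tagged D *m B) | D <- s].
  split=> [D /mapP[E /sP Es ->]|]; first exact: irreducible_block_comp.
  rewrite big_map -[B^t* in RHS]mulmx1 -s1 mulmx_sumr mulmx_suml.
  by apply: eq_bigr => D _; rewrite /= trmxC_mul !mulmxA.
have [s1 [s1P s1E]] := part _ B1 rU uB1 sB1.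
have [s2 [s2P s2E]] := part _ B2 rU' uB2 sB2.
exists (s1 ++ s2); split; last by rewrite big_cat /= s1E s2E.
by move=> B; rewrite mem_cat => /orP[/s1P|/s2P].
Qed.

(** Schur's lemma: an eigenspace of [Z] is nonzero, and stable because [Z] commutes with the family,
    hence it is the whole space. *)
Lemma irreducible_family_scalar (T : Type) n (rho : T -> 'M[C]_n)
    (Z : 'M[C]_n) :
  (0 < n)%N -> irreducible_family rho -> (forall x, comm_mx Z (rho x)) ->
  exists c, Z = c%:M.
Proof.
move=> n0 irr cZ; have [c cE] := eigenvalue_closed Z n0; exists c.
have [] := irr (eigenspace Z c).
- by move=> x; apply: comm_mx_stable_eigenspace.
- by move/eqP; rewrite (negPf cE).
- rewrite -sub1mx => /submxP[X X1].
  apply/eqP; rewrite -subr_eq0; apply/eqP.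
  have : eigenspace Z c *m (Z - c%:M) = 0 by exact: mulmx_ker.
  by move/(congr1 (mulmx X)); rewrite mulmxA -X1 mul1mx mulmx0.
Qed.

End UnitaryDecomposition.

(** * Norms of families of skew-Hermitian matrices *)

Section SkewHermitian.
Variables (C : numClosedFieldType) (m n : nat).
Implicit Types (A B : 'I_m -> 'M[C]_n) (w : 'rV[C]_n).

(** The rows [w *m A i] are concatenated into one vector, so that the norm of the family is an
    ordinary Hermitian norm, subject to the triangle inequality. *)
Definition stack A w : 'rV[C]_(m * n) := mxvec (\matrix_i (w *m A i)).

Lemma dotmx_stack A B w :
  dotmx (stack A w) (stack B w) = (w *m (\sum_i A i *m (B i)^t*) *m w^t*) 0 0.
Proof.
rewrite dotmxE mulmx_sumr mulmx_suml summxE mxE.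
transitivity (\sum_i \sum_j stack A w 0 (mxvec_index i j) *
    (stack B w)^t* (mxvec_index i j) 0).
  by rewrite pair_bigA (reindex _ (curry_mxvec_bij _ _)); apply: eq_bigr => -[].
apply: eq_bigr => i _.
have -> : w *m (A i *m (B i)^t*) *m w^t* = (w *m A i) *m (w *m B i)^t*.
  by rewrite trmxC_mul !mulmxA.
by rewrite mxE; apply: eq_bigr => j _; rewrite !mxE !mxvecE !mxE.
Qed.

Lemma dnorm_stack A w :
  (forall i, (A i)^t* = - A i) ->
  dotmx (stack A w) (stack A w) = - (w *m (\sum_i A i *m A i) *m w^t*) 0 0.
Proof.
move=> skA; rewrite dotmx_stack.
have -> : \sum_i A i *m (A i)^t* = - \sum_i A i *m A i.
  by rewrite -sumrN; apply: eq_bigr => i _; rewrite skA mulmxN.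
by rewrite mulmxN mulNmx mxE.
Qed.

Lemma skew_quadratic_le0 A w :
  (forall i, (A i)^t* = - A i) ->
  0 <= - (w *m (\sum_i A i *m A i) *m w^t*) 0 0.
Proof. by move=> skA; rewrite -dnorm_stack // dnorm_ge0. Qed.

(** The numbers [a], [b] and [l] are the norms of the stacks of [A], [B] and [A + B] at [w], and the
    last stack is the sum of the first two. The condition on [A + B] is imposed at [w] only, because
    the Casimir matrix of a tensor product is in general scalar on each irreducible constituent but
    not globally. *)
Lemma skew_triangle A B w (a b l : C) :
  (forall i, (A i)^t* = - A i) -> (forall i, (B i)^t* = - B i) ->
  0 <= a -> 0 <= b -> 0 <= l -> w *m w^t* = 1%:M ->
  \sum_i A i *m A i = (- a ^+ 2)%:M -> \sum_i B i *m B i = (- b ^+ 2)%:M ->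
  (w *m (\sum_i (A i + B i) *m (A i + B i)) *m w^t*) 0 0 = - l ^+ 2 ->
  [/\ l <= a + b, a <= l + b & b <= l + a].
Proof.
move=> skA skB a0 b0 l0 w1 AE BE ABE.
have skAB i : (A i + B i)^t* = - (A i + B i).
  by rewrite raddfD map_mxD skA skB opprD.
pose hn := fun u : 'rV[C]_(m * n) => sqrtC (dotmx u u).
have scal (c : C) : (w *m (- c ^+ 2)%:M *m w^t*) 0 0 = - c ^+ 2.
  by rewrite mul_mx_scalar -scalemxAl w1 !mxE eqxx mulr1.
have na : hn (stack A w) = a by rewrite /hn dnorm_stack // AE scal opprK sqrCK.
have nb : hn (stack B w) = b by rewrite /hn dnorm_stack // BE scal opprK sqrCK.
have nl : hn (stack A w + stack B w) = l.
  have -> : stack A w + stack B w = stack (fun i => A i + B i) w.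
    rewrite -raddfD; congr mxvec; apply/row_matrixP => i.
    by rewrite raddfD /= !rowK mulmxDr.
  by rewrite /hn dnorm_stack // ABE opprK sqrCK.
have hnN u : hn (- u) = hn u by rewrite /hn hnormN.
have tri u v : hn (u + v) <= hn u + hn v.
  by have [] := triangle_lerif (@dotmx C (m * n)) u v.
split.
- by rewrite -nl -na -nb tri.
- rewrite -na -nl -nb -(hnN (stack B w)).
  by apply: le_trans (tri _ _); rewrite addrK.
- rewrite -na -nl -nb -(hnN (stack A w)).
  by apply: le_trans (tri _ _); rewrite addrAC subrr add0r.
Qed.

End SkewHermitian.

(** * Kronecker products and the bilinear form giving matrix coefficients *)

Section TensorProduct.
Variable F : comPzRingType.

Lemma tensmx_suml (I : Type) (r : seq I) p q s t (A : I -> 'M[F]_(p, q))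
    (B : 'M[F]_(s, t)) :
  (\sum_(i <- r) A i) *t B = \sum_(i <- r) A i *t B.
Proof.
apply/matrixP => i j; rewrite summxE !mxE summxE mulr_suml.
by apply: eq_bigr => k _; rewrite mxE.
Qed.

Lemma tensmx_sumr (I : Type) (r : seq I) p q s t (A : 'M[F]_(p, q))
    (B : I -> 'M[F]_(s, t)) :
  A *t (\sum_(i <- r) B i) = \sum_(i <- r) A *t B i.
Proof.
apply/matrixP => i j; rewrite summxE !mxE summxE mulr_sumr.
by apply: eq_bigr => k _; rewrite mxE.
Qed.

Lemma tensmx11 p q : (1%:M : 'M[F]_p) *t (1%:M : 'M[F]_q) = 1%:M.
Proof.
apply/matrixP => i j; rewrite !mxE -natrM mulnb.
rewrite -(inj_eq (can_inj (@mxtens_unindexK p q))).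
by case: (mxtens_unindex i) (mxtens_unindex j) => [? ?] [].
Qed.

Lemma tens_scalarl p q (c : F) : (c%:M : 'M[F]_p) *t (1%:M : 'M[F]_q) = c%:M.
Proof.
rewrite -[RHS]scalemx1 -tensmx11 -[c%:M]scalemx1.
by apply/matrixP => i j; rewrite !mxE mulrA.
Qed.

Lemma tens_scalarr p q (c : F) : (1%:M : 'M[F]_p) *t (c%:M : 'M[F]_q) = c%:M.
Proof.
rewrite -[RHS]scalemx1 -tensmx11 -[c%:M]scalemx1.
by apply/matrixP => i j; rewrite !mxE mulrCA.
Qed.

(** Bilinear, without conjugation: the elements of [matrix_coefs xi] are the functions sending [x]
    to [pairing A (xi x)]. *)
Definition pairing p q (A M : 'M[F]_(p, q)) : F := \sum_i \sum_j A i j * M i j.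

Lemma pairing_trace p q (A M : 'M[F]_(p, q)) : pairing A M = \tr (A^T *m M).
Proof.
rewrite /pairing exchange_big; apply: eq_bigr => i _.
by rewrite mxE; apply: eq_bigr => j _; rewrite mxE.
Qed.

(** Cyclicity of the trace. It moves the change of basis from the representation onto the
    coefficient matrix. *)
Lemma pairing_conj p q r s (A : 'M[F]_(p, q)) (B : 'M[F]_(p, r))
    (D : 'M[F]_(s, q)) (M : 'M[F]_(r, s)) :
  pairing A (B *m M *m D) = pairing (B^T *m A *m D^T) M.
Proof.
rewrite !pairing_trace !trmx_mul !trmxK mulmxA mxtrace_mulC !mulmxA.
by [].
Qed.

Lemma pairing_tens p q r s (A M : 'M[F]_(p, q)) (B N : 'M[F]_(r, s)) :
  pairing A M * pairing B N = pairing (A *t B) (M *t N).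
Proof.
rewrite /pairing mulr_sum; apply: eq_bigr => k _.
rewrite mulr_sum; apply: eq_bigr => l _.
by rewrite !mxE mulrACA.
Qed.

Lemma pairing_delta p q (M : 'M[F]_(p, q)) i j :
  pairing (delta_mx i j) M = M i j.
Proof.
rewrite /pairing (bigD1 i) //= [X in _ + X]big1 => [|k ki]; last first.
  by rewrite big1 // => l _; rewrite mxE (negPf ki) mul0r.
rewrite addr0 (bigD1 j) //= big1 => [|l lj].
  by rewrite mxE !eqxx mul1r addr0.
by rewrite mxE (negPf lj) andbF mul0r.
Qed.

Lemma pairing_sumr (I : Type) (r : seq I) p q (A : 'M[F]_(p, q))
    (M : I -> 'M[F]_(p, q)) :
  pairing A (\sum_(k <- r) M k) = \sum_(k <- r) pairing A (M k).
Proof.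
rewrite pairing_trace mulmx_sumr raddf_sum.
by apply: eq_bigr => k _; rewrite pairing_trace.
Qed.

Lemma pairingZr p q (A M : 'M[F]_(p, q)) c :
  pairing A (c *: M) = c * pairing A M.
Proof. by rewrite !pairing_trace -scalemxAr mxtraceZ. Qed.

End TensorProduct.

(** * Differential calculus and translations *)

Section Ck.
Variable R : realType.
Implicit Types (V W : normedModType R) (k : nat).

(** The first-order expansion of [f] at [x] is also one of [g], and the linear part of such an
    expansion is unique. *)
Lemma diff_near_eq V W (f g : V -> W) x :
  {near x, f =1 g} -> differentiable f x ->
  differentiable g x /\ 'd g x = 'd f x :> (V -> W).
Proof.
move=> fg df.
have fgx : f x = g x by exact: (nbhs_singleton fg).
have gE : g \o shift x = cst (g x) + 'd f x +o_ 0 id.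
  apply/eqaddoP => e e0.
  have /eqaddoP/(_ e e0) fo := diff_locally df.
  have fg0 : \forall h \near 0, f (h + x) = g (h + x).
    move: fg; rewrite (near_shift 0 x); apply: filterS => h /=.
    by rewrite subr0.
  by apply: filterS2 fo fg0 => h; rewrite !fctE /= => + fgh; rewrite fgh fgx.
have dgE := diff_unique (@diff_continuous _ _ _ _ _ df) gE.
split; last exact: dgE.
by apply/diff_locallyP; rewrite dgE; split; [exact: diff_continuous|exact: gE].
Qed.

(** Openness of [U] turns equality on [U] into equality near each of its points, which is all that
    differentials see. The closure properties below use it to replace a differential by its computed
    value. *)
Lemma Ck_eq V W k (U : set V) (f g : V -> W) :
  open U -> (forall x, U x -> f x = g x) -> Ck k U f -> Ck k U g.
Proof.
move=> oU; elim: k f g => [|k IH] f g fg /=.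
  move=> fc x Ux; have fgx : {near x, f =1 g}.
    by apply: filterS (open_nbhs_nbhs (conj oU Ux)) => y /fg.
  apply: (@cvg_trans _ (f @ x)).
    by apply: near_eq_cvg; apply: filterS fgx => y ->.
  by rewrite /= -(fg _ Ux); exact: fc.
move=> [df dCk].
have fg_near x : U x -> {near x, f =1 g}.
  by move=> Ux; apply: filterS (open_nbhs_nbhs (conj oU Ux)) => y /fg.
split=> [x Ux|v]; first by have [] := diff_near_eq (fg_near _ Ux) (df _ Ux).
apply: IH (dCk v) => x Ux.
have [_ dfg] := diff_near_eq (fg_near _ Ux) (df _ Ux).
exact: esym (congr1 (@^~ v) dfg).
Qed.

Lemma Ck_local V W k (U : set V) (f : V -> W) :
  (forall x, U x -> exists2 O : set V, O x & Ck k O f) -> Ck k U f.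
Proof.
elim: k f => [|k IH] f /= Uf; first by move=> x /Uf[A Ax fc]; exact: fc.
split=> [x /Uf[A Ax [df _]]|v]; first exact: df.
by apply: IH => x /Uf[A Ax [_ /(_ v) ?]]; exists A.
Qed.

Lemma CkW V W k (U : set V) (f : V -> W) : Ck k.+1 U f -> Ck k U f.
Proof.
elim: k f => [|k IH] f [df dCk] /=.
  by move=> x Ux; apply: differentiable_continuous; exact: df.
by split=> // v; apply: IH; exact: dCk.
Qed.

Lemma Ck_cst V W k (U : set V) (c : W) : Ck k U (fun=> c).
Proof.
elim: k c => [|k IH] c /=; first by move=> x _; exact: cst_continuous.
split=> [x _|v]; first exact: differentiable_cst.
rewrite (_ : (fun x => _) = fun=> 0); first exact: IH.
by apply/funext => x; rewrite diff_cst.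
Qed.

Lemma CkD V W k (U : set V) (f g : V -> W) :
  open U -> Ck k U f -> Ck k U g -> Ck k U (fun x => f x + g x).
Proof.
move=> oU; elim: k f g => [|k IH] f g /=.
  by move=> fc gc x Ux; apply: continuousD; [exact: fc|exact: gc].
move=> [df fC] [dg gC]; split=> [x Ux|v].
  by apply: differentiableD; [exact: df|exact: dg].
apply: Ck_eq (IH _ _ (fC v) (gC v)) => // x Ux.
exact: esym (congr1 (@^~ v) (diffD (df _ Ux) (dg _ Ux))).
Qed.

Lemma Ck_sum V W k (U : set V) m (f : 'I_m -> V -> W) :
  open U -> (forall i, Ck k U (f i)) -> Ck k U (fun x => \sum_i f i x).
Proof.
move=> oU fC; elim: m f fC => [|m IH] f fC.
  by apply: Ck_eq (Ck_cst k U 0) => // x _; rewrite big_ord0.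
apply: (Ck_eq oU _ (CkD oU (IH _ (fun i => fC (widen_ord (leqnSn m) i)))
  (fC ord_max))) => x _.
by rewrite big_ord_recr.
Qed.

Lemma CkM V k (U : set V) (f g : V -> R^o) :
  open U -> Ck k U f -> Ck k U g -> Ck k U (fun x => f x * g x : R^o).
Proof.
move=> oU; elim: k f g => [|k IH] f g fC gC.
  by move=> x Ux; apply: continuousM; [exact: fC|exact: gC].
have [df dfC] := fC; have [dg dgC] := gC.
split=> [x Ux|v].
  by apply: (@differentiableM R V f g); [exact: df|exact: dg].
apply: Ck_eq (CkD oU (IH _ _ (CkW fC) (dgC v)) (IH _ _ (CkW gC) (dfC v))) => //.
move=> x Ux; have /(congr1 (@^~ v)) /= := diffM (df _ Ux) (dg _ Ux).
by move=> dfg; rewrite [RHS]dfg.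
Qed.

Lemma Ck_linear_comp V W (W' : normedModType R) k (U : set V)
    (l : {linear W -> W'}) (f : V -> W) :
  continuous l -> open U -> Ck k U f -> Ck k U (fun x => l (f x)).
Proof.
move=> lc oU; elim: k f => [|k IH] f /=.
  by move=> fc x Ux; apply: continuous_comp; [exact: fc|exact: lc].
move=> [df fC].
have dl y : differentiable l y by exact: linear_differentiable.
split=> [x Ux|v]; first by apply: differentiable_comp => //; exact: df.
apply: Ck_eq (IH _ (fC v)) => // x Ux.
have /(congr1 (@^~ v)) /= dlf := diff_comp (df _ Ux) (dl (f x)).
by rewrite [RHS]dlf diff_lin.
Qed.

Lemma Ck_coord V k n (U : set V) (f : V -> 'rV[R]_n) j :
  open U -> Ck k U f -> Ck k U (fun x => f x 0 j : R^o).
Proof.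
have @l : {linear 'rV[R]_n -> R^o}.
  by exists (fun N : 'rV[R]_n => N 0 j); do 2![eexists]; do ?[constructor];
     rewrite ?mxE// => ? *; rewrite ?mxE//; move=> ?; rewrite !mxE.
by apply: (@Ck_linear_comp V _ _ k U l); exact: coord_continuous.
Qed.

(* [Ck] only sees derivatives along fixed vectors, hence the chain rule is
   expanded on the standard basis of the intermediate space. *)
Lemma Ck_comp V k n (U : set V) (O : set 'rV[R]_n) (f : V -> 'rV[R]_n)
    (g : 'rV[R]_n -> R^o) :
  open U -> (forall x, U x -> O (f x)) -> Ck k U f -> Ck k O g ->
  Ck k U (fun x => g (f x)).
Proof.
move=> oU UO; elim: k g => [|k IH] g fC gC.
  by move=> x Ux; apply: continuous_comp; [exact: fC|exact/gC/UO].
have [df dfC] := fC; have [dg dgC] := gC.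
split=> [x Ux|v].
  by apply: differentiable_comp; [exact: df|exact/dg/UO].
pose h j x : R^o := 'd f x v 0 j * 'd g (f x) (delta_mx 0 j).
have hC : Ck k U (fun x => \sum_j h j x).
  apply: Ck_sum => // j; apply: CkM => //; first exact: Ck_coord (dfC v).
  exact: (IH (fun y => 'd g y (delta_mx 0 j)) (CkW fC) (dgC _)).
apply: Ck_eq hC => // x Ux.
have /(congr1 (@^~ v)) /= dgf := diff_comp (df _ Ux) (dg _ (UO _ Ux)).
rewrite [RHS]dgf [in RHS](row_sum_delta ('d f x v)) linear_sum /=.
by apply: eq_bigr => j _; rewrite linearZ.
Qed.

(** The differential of the composite along [v] is that of [f] along the fixed vector [l v], so no
    basis is involved and the intermediate space is arbitrary. This serves to freeze one variable of
    the group multiplication, whose domain in charts is a product space. *)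
Lemma Ck_comp_affine V (V' W : normedModType R) k (U : set V) (O : set V')
    (l : {linear V -> V'}) (c : V') (f : V' -> W) :
  continuous l -> open U -> (forall x, U x -> O (l x + c)) -> Ck k O f ->
  Ck k U (fun x => f (l x + c)).
Proof.
move=> lc oU UO; elim: k f => [|k IH] f /=.
  move=> fc x Ux; apply: (@continuous_comp _ _ _ (fun x => l x + c) f).
    by apply: continuousD; [exact: lc|exact: cst_continuous].
  exact/fc/UO.
move=> [df fC].
have dl x : differentiable (fun x => l x + c) x.
  by apply: differentiableD => //; exact: linear_differentiable.
have dlE x : 'd (fun x => l x + c) x = l :> (V -> V').
  have dlx : differentiable l x by exact: linear_differentiable.
  rewrite (diffD dlx (differentiable_cst c x)) diff_cst diff_lin //.
  by apply/funext => v /=; rewrite addr0.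
split=> [x Ux|v].
  by apply: (@differentiable_comp _ _ _ _ (fun x => l x + c) f);
    [exact: dl|exact/df/UO].
apply: (Ck_eq oU _ (IH _ (fC (l v)))) => x Ux.
have /(congr1 (@^~ v)) /= dfl := diff_comp (dl x) (df _ (UO _ Ux)).
by rewrite [RHS]dfl dlE.
Qed.

End Ck.

(** * Smooth functions on the group and their right translates *)

Section Smooth.
Variables (R : realType) (n : nat) (G : lieGroupType R n).
Implicit Types (f g : G -> R^o).

Lemma open_cimg (phi : chart R n G) : open (cimg phi).
Proof. exact: cimg_open. Qed.

Lemma smooth_cst (c : R) : smooth (fun _ : G => c : R^o).
Proof. by move=> phi _ k; exact: Ck_cst. Qed.

Lemma smoothD f g : smooth f -> smooth g -> smooth (fun x => f x + g x).
Proof.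
move=> sf sg phi aphi k.
exact: (CkD (@open_cimg phi) (sf _ aphi k) (sg _ aphi k)).
Qed.

Lemma smoothM f g : smooth f -> smooth g -> smooth (fun x => f x * g x : R^o).
Proof.
move=> sf sg phi aphi k.
exact: (CkM (@open_cimg phi) (sf _ aphi k) (sg _ aphi k)).
Qed.

Lemma mulgr_continuous (h : G) : continuous (fun x : G => (x * h)%g).
Proof.
move=> x; apply: (@continuous_comp _ _ _ (fun x => (x, h))
  (fun p => (p.1 * p.2)%g)).
  by apply: cvg_pair; [exact: cvg_id|exact: cvg_cst].
exact: (@mulg_continuous R n G).
Qed.

(** In charts, right multiplication by [h] is the multiplication with its second variable frozen at
    the coordinates of [h]; [f] is then composed with it through a chart [psi] around the
    product. *)
Lemma smooth_rtranslate f (h : G) : smooth f -> smooth (fun x => f (x * h)%g).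
Proof.
move=> sf phi aphi k; apply: Ck_local => v phiv.
have [chi achi chih] := @lie_atlas_cover R n G h.
have [psi apsi psivh] := @lie_atlas_cover R n G (cinv phi v * h)%g.
(* The translate is studied only where the product stays in the domain of [psi]; continuity of the
   multiplication makes this set open. *)
pose U := cimg phi `&` (fun v => (cinv phi v * h)%g) @^-1` cdom psi.
have oU : open U.
  rewrite openE => w [phiw psiw]; apply: filterI.
    exact: open_nbhs_nbhs (conj (@open_cimg phi) phiw).
  have mc : {for w, continuous (fun v => (cinv phi v * h)%g)}.
    apply: (@continuous_comp _ _ _ (cinv phi) (fun x => (x * h)%g)).
      exact: cinv_continuous.
    exact: mulgr_continuous.
  by apply: mc; exact: open_nbhs_nbhs (conj (@cdom_open _ _ _ psi) psiw).
exists U; first by split.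
pose O' := [set v : 'rV[R]_n * 'rV[R]_n | [/\ cimg phi v.1, cimg chi v.2 &
                     cdom psi (cinv phi v.1 * cinv chi v.2)%g]].
pose w0 := cfun chi h.
have chiw0 : cimg chi w0 by exists h.
have w0K : cinv chi w0 = h by exact: cfunK.
(* The map freezing the second variable sends [w] to [(w, w0)]; it is split into the linear map [d]
   and the constant [(0, w0)] so as to be affine. *)
pose d (v : 'rV[R]_n) : 'rV[R]_n * 'rV[R]_n := (v, 0).
have d_lin : linear d.
  by move=> a v1 v2; congr pair; rewrite /= scaler0 addr0.
pose d_isLinear := GRing.isLinear.Build R _ _ _ d d_lin.
pose l : {linear _ -> _} := HB.pack d d_isLinear.
have lE w : l w + (0, w0) = (w, w0).
  by rewrite /l /=; congr pair; rewrite ?addr0 ?add0r.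
have lc : continuous l.
  move=> w; have dw : differentiable (fun v : 'rV[R]_n => (v, 0 : 'rV[R]_n)) w.
    exact: differentiable_pair.
  exact: differentiable_continuous dw.
pose t w := cfun psi (cinv phi w * h)%g.
have tC : Ck k U t.
  have UO w : U w -> O' (l w + (0, w0)).
    by rewrite lE /O' /= w0K => -[? ?]; split.
  have := Ck_comp_affine lc oU UO (mulg_smooth _ _ _ aphi achi apsi k).
  by apply: Ck_eq => // w _; rewrite lE /= w0K.
have tU w : U w -> cimg psi (t w) by move=> [_ psiw]; exists (cinv phi w * h)%g.
apply: Ck_eq (Ck_comp oU tU tC (sf _ apsi k)) => // w [_ psiw].
by rewrite /t /= cfunK.
Qed.

End Smooth.

(** * Left-invariant fields and the Killing form *)

Section LieAlgebraTheory.
Variables (R : realType) (n : nat) (G : lieGroupType R n).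
Implicit Types (X Y Z : oper G) (f h : G -> R^o) (g : G).
Local Notation LA := (@lie_algebra R n G).

Lemma operDE X Y f x : (X + Y) f x = X f x + Y f x. Proof. by []. Qed.

Lemma operZE (a : R) X f x : (a *: X) f x = a * X f x. Proof. by []. Qed.

Lemma oper_sumE (I : Type) (r : seq I) (P : pred I) (F : I -> oper G) f x :
  (\sum_(i <- r | P i) F i) f x = \sum_(i <- r | P i) F i f x.
Proof. by elim/big_rec2: _ => // i y Y _ <-. Qed.

Lemma smoothZ (a : R) f : smooth f -> smooth (a *: f).
Proof. by move=> sf; exact: (smoothM (smooth_cst a) sf). Qed.

Lemma smooth0 : smooth (0 : G -> R^o).
Proof. exact: smooth_cst. Qed.

Section VectorField.
Variables (X : oper G) (vX : vector_field X).

Lemma vf_smooth f : smooth f -> smooth (X f).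
Proof. by have [sX _ _ _] := vX; exact: sX. Qed.

Lemma vf_notsmooth f : ~ smooth f -> X f = 0.
Proof. by have [_ sX _ _] := vX; exact: sX. Qed.

Lemma vf_lin (a : R) f h : smooth f -> smooth h ->
  X (a *: f + h) = a *: X f + X h.
Proof. by have [_ _ + _] := vX; apply. Qed.

Lemma vfM f h : smooth f -> smooth h -> X (f \* h) = (X f \* h) + (f \* X h).
Proof. by have [_ _ _ +] := vX; apply. Qed.

Lemma vf0 : X 0 = 0.
Proof.
have := vf_lin 1 smooth0 smooth0; rewrite scaler0 addr0 scale1r => E.
by apply: (addrI (X 0)); rewrite -E addr0.
Qed.

Lemma vfZ (a : R) f : smooth f -> X (a *: f) = a *: X f.
Proof.
move=> sf; rewrite -[a *: f]addr0 vf_lin ?vf0 ?addr0 //; exact: smooth0.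
Qed.

Lemma vfD f h : smooth f -> smooth h -> X (f + h) = X f + X h.
Proof. by move=> sf sh; rewrite -[f]scale1r vf_lin // !scale1r. Qed.

Lemma vfB f h : smooth f -> smooth h -> X (f - h) = X f - X h.
Proof.
by move=> sf sh; rewrite addrC -scaleN1r vf_lin // scaleN1r addrC.
Qed.

(** The Leibniz rule for [1 = 1 * 1] gives [X 1 = X 1 + X 1]. *)
Lemma vf_cst (a : R) : X (cst (a : R^o)) = 0.
Proof.
have E1 : X (cst (1 : R^o)) = 0.
  have := vfM (smooth_cst 1) (smooth_cst 1).
  rewrite (_ : cst 1 \* cst 1 = cst 1); last first.
    by apply/funext => x /=; rewrite mulr1.
  move=> E; apply: (addrI (X (cst (1 : R^o)))).
  rewrite addr0 [RHS]E; apply/funext => x /=.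
  by rewrite !fctE /= mulr1 mul1r.
rewrite (_ : cst a = a *: cst (1 : R^o)); last first.
  by apply/funext => x; rewrite !fctE /= [RHS]mulr1.
by rewrite vfZ ?E1 ?scaler0 //; exact: smooth_cst.
Qed.

End VectorField.

Lemma LA_vf X : LA X -> vector_field X. Proof. by case. Qed.

Lemma LA_lin (a : R) X Y : LA X -> LA Y -> LA (a *: X + Y).
Proof.
move=> [vX lX] [vY lY]; split; first split.
- move=> f sf; apply: smoothD; last exact: vf_smooth.
  by apply: smoothZ; exact: vf_smooth.
- move=> f sf; apply/funext => x.
  rewrite operDE operZE (vf_notsmooth vX sf) (vf_notsmooth vY sf).
  by rewrite mulr0 addr0.
- move=> c f h sf sh; apply/funext => x; rewrite operDE operZE.
  rewrite (vf_lin vX) // (vf_lin vY) // !fctE.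
  change (a * (c * X f x + X h x) + (c * Y f x + Y h x) =
    c * (a * X f x + Y f x) + (a * X h x + Y h x)).
  ring.
- move=> f h sf sh; apply/funext => x; rewrite operDE operZE.
  rewrite (vfM vX) // (vfM vY) //.
  change (a * (X f x * h x + f x * X h x) + (Y f x * h x + f x * Y h x) =
    (a * X f x + Y f x) * h x + f x * (a * X h x + Y h x)).
  ring.
- move=> g f sf; apply/funext => x; rewrite operDE operZE.
  by rewrite (lX g f sf) (lY g f sf).
Qed.

Lemma LA0 : LA 0.
Proof.
split; first split.
- by move=> f _; exact: smooth0.
- by [].
- by move=> a f h _ _; rewrite scaler0 addr0.
- move=> f h _ _; apply/funext => x.
  by change (0 = 0 * h x + f x * 0); rewrite mul0r mulr0 addr0.
- by [].
Qed.

Lemma LAB X Y : LA X -> LA Y -> LA (X - Y).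
Proof. by move=> lX lY; rewrite addrC -scaleN1r; exact: LA_lin. Qed.

Lemma LA_sum (I : Type) (r : seq I) (P : pred I) (a : I -> R)
    (b : I -> oper G) :
  (forall i, LA (b i)) -> LA (\sum_(i <- r | P i) a i *: b i).
Proof.
move=> lb; elim/big_rec: _ => [|i X _ lX]; first exact: LA0.
exact: LA_lin.
Qed.

Lemma lie_bracket_linr (a : R) X Y Z : LA X -> LA Y -> LA Z ->
  lie_bracket X (a *: Y + Z) = a *: lie_bracket X Y + lie_bracket X Z.
Proof.
move=> /LA_vf vX /LA_vf vY /LA_vf vZ; apply/funext => f; apply/funext => x.
rewrite /lie_bracket.
have [sf|sf] := pselect (smooth f).
  have -> : X ((a *: Y + Z) f) = a *: X (Y f) + X (Z f).
    by rewrite -(vf_lin vX) //; exact: vf_smooth.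
  change (a * X (Y f) x + X (Z f) x - (a * Y (X f) x + Z (X f) x) =
    a * (X (Y f) x - Y (X f) x) + (X (Z f) x - Z (X f) x)).
  ring.
(* Off the smooth functions all fields take the value 0, so both sides vanish there; this case is
   needed since equality of operators is tested on every function. *)
have -> : (a *: Y + Z) f = 0.
  apply/funext => y; rewrite operDE operZE (vf_notsmooth vY sf).
  by rewrite (vf_notsmooth vZ sf) mulr0 addr0.
change (X 0 x - (a * Y (X f) x + Z (X f) x) =
    a * (X (Y f) x - Y (X f) x) + (X (Z f) x - Z (X f) x)).
rewrite (vf_notsmooth vX sf) (vf_notsmooth vY sf) (vf_notsmooth vZ sf).
rewrite (vf0 vX) (vf0 vY) (vf0 vZ).
by change (0 - (a * 0 + 0) = a * (0 - 0) + (0 - 0) :> R); ring.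
Qed.

Lemma jacobi X Y Z : LA X -> LA Y -> LA Z ->
  lie_bracket (lie_bracket X Y) Z =
  lie_bracket X (lie_bracket Y Z) - lie_bracket Y (lie_bracket X Z).
Proof.
move=> /LA_vf vX /LA_vf vY /LA_vf vZ; apply/funext => f; apply/funext => x.
change (lie_bracket (lie_bracket X Y) Z f x =
  lie_bracket X (lie_bracket Y Z) f x - lie_bracket Y (lie_bracket X Z) f x).
rewrite /lie_bracket.
have [sf|sf] := pselect (smooth f).
  have s1 U : vector_field U -> smooth (U f).
    by move=> vU; exact: vf_smooth vU _ sf.
  have s2 U V : vector_field U -> vector_field V -> smooth (U (V f)).
    by move=> vU vV; exact: vf_smooth vU _ (s1 _ vV).
  rewrite (vfB vX (s2 Y Z vY vZ) (s2 Z Y vZ vY)).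
  rewrite (vfB vY (s2 X Z vX vZ) (s2 Z X vZ vX)).
  rewrite (vfB vZ (s2 X Y vX vY) (s2 Y X vY vX)).
  change (X (Y (Z f)) x - Y (X (Z f)) x - (Z (X (Y f)) x - Z (Y (X f)) x) =
   X (Y (Z f)) x - X (Z (Y f)) x - (Y (Z (X f)) x - Z (Y (X f)) x) -
   (Y (X (Z f)) x - Y (Z (X f)) x - (X (Z (Y f)) x - Z (X (Y f)) x))).
  ring.
rewrite (vf_notsmooth vX sf) (vf_notsmooth vY sf) (vf_notsmooth vZ sf).
by rewrite !(vf0 vX, vf0 vY, vf0 vZ, subrr).
Qed.

End LieAlgebraTheory.

(** * Coordinates, traces and the Killing form on the Lie algebra *)

Section Killing.
Variables (R : realType) (n : nat) (G : lieGroupType R n).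
Implicit Types (X Y Z W : oper G).
Local Notation LA := (@lie_algebra R n G).

Lemma lie_basis_inj m (b : 'I_m -> oper G) k (A A' : 'M[R]_(k, m)) :
  lie_basis b ->
  (forall i, \sum_j A i j *: b j = \sum_j A' i j *: b j) -> A = A'.
Proof.
move=> [lb ub] AA'; apply/row_matrixP => i.
have [a [_ ua]] := ub _ (LA_sum (index_enum 'I_m) predT (A i) lb).
rewrite -(ua (row i A)); last by apply: eq_bigr => j _; rewrite mxE.
by rewrite -(ua (row i A')) // AA'; apply: eq_bigr => j _; rewrite mxE.
Qed.

Lemma lie_basis_mx m (b : 'I_m -> oper G) k (X : 'I_k -> oper G) :
  lie_basis b -> (forall i, LA (X i)) ->
  exists A : 'M[R]_(k, m), forall i, X i = \sum_j A i j *: b j.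
Proof.
move=> [lb ub] lX.
have /fin_all_exists[a aE] i : exists a : 'rV[R]_m, X i = \sum_j a 0 j *: b j.
  by have [a [aE _]] := ub _ (lX i); exists a.
exists (\matrix_i a i) => i; rewrite {1}aE.
by apply: eq_bigr => j _; rewrite mxE.
Qed.

(** Coordinates are rows, so successive expansions multiply from left to right, and the matrix of a
    composite map is the product in reversed order. *)
Lemma comb_mulmx k m p (A : 'M[R]_(k, m)) (P : 'M[R]_(m, p))
    (c : 'I_p -> oper G) i :
  \sum_j A i j *: (\sum_l P j l *: c l) = \sum_l (A *m P) i l *: c l.
Proof.
under eq_bigr do rewrite scaler_sumr.
rewrite exchange_big; apply: eq_bigr => l _.
by rewrite mxE scaler_suml; apply: eq_bigr => j _; rewrite scalerA.
Qed.

Definition lie_linear (T : oper G -> oper G) : Prop :=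
  forall (a : R) X Y, LA X -> LA Y -> T (a *: X + Y) = a *: T X + T Y.

Lemma lie_linear_sum T m (a : 'I_m -> R) (b : 'I_m -> oper G) :
  lie_linear T -> (forall i, LA (b i)) ->
  T (\sum_i a i *: b i) = \sum_i a i *: T (b i).
Proof.
move=> lT lb.
have T0 : T 0 = 0.
  have := lT 1 _ _ (@LA0 R n G) (@LA0 R n G).
  rewrite scaler0 addr0 scale1r => E.
  by apply: (addrI (T 0)); rewrite -E addr0.
elim: (index_enum _) => [|i r IH]; first by rewrite !big_nil.
by rewrite !big_cons lT ?IH //; exact: LA_sum.
Qed.

(** Two bases are related by transition matrices [P] and [Q], inverse to each other although their
    sizes are not known in advance to agree. Then [P *m A = A' *m P], and cyclicity of the trace
    concludes. *)
Lemma is_trace_unique T t t' :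
  lie_linear T -> is_trace T t -> is_trace T t' -> t = t'.
Proof.
move=> lT [m [b [A [bb bA ->]]]] [m' [b' [A' [bb' bA' ->]]]].
have [P PE] := lie_basis_mx bb (fun i => bb'.1 i).
have [Q QE] := lie_basis_mx bb' (fun i => bb.1 i).
have QP : Q *m P = 1%:M.
  apply: (lie_basis_inj bb) => i; rewrite -comb_mulmx.
  under eq_bigr do rewrite -PE.
  rewrite -QE (bigD1 i) //= big1 => [|j ji].
    by rewrite mxE eqxx scale1r addr0.
  by rewrite mxE eq_sym (negPf ji) scale0r.
have PQ : P *m Q = 1%:M.
  apply: (lie_basis_inj bb') => i; rewrite -comb_mulmx.
  under eq_bigr do rewrite -QE.
  rewrite -PE (bigD1 i) //= big1 => [|j ji].
    by rewrite mxE eqxx scale1r addr0.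
  by rewrite mxE eq_sym (negPf ji) scale0r.
have PA : P *m A = A' *m P.
  apply: (lie_basis_inj bb) => i; rewrite -!comb_mulmx.
  under eq_bigr do rewrite -bA.
  rewrite -(lie_linear_sum _ lT bb.1) -PE bA'.
  by apply: eq_bigr => j _; rewrite -PE.
by rewrite -[A']mulmx1 -PQ mulmxA -PA -mulmxA mxtrace_mulC -mulmxA QP mulmx1.
Qed.

Lemma lie_linear_ad X : LA X -> lie_linear (lie_bracket X).
Proof. by move=> lX a Y Z lY lZ; exact: lie_bracket_linr. Qed.

Section NegKilling.
Variable q : oper G -> oper G -> R.
Hypothesis qK : neg_killing_metric q.
Hypothesis bracketLA : forall X Y, LA X -> LA Y -> LA (lie_bracket X Y).

Lemma lie_linear_adad X Y : LA X -> LA Y ->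
  lie_linear (fun Z => lie_bracket X (lie_bracket Y Z)).
Proof.
move=> lX lY a Z W lZ lW.
by rewrite (lie_linear_ad lY) // (lie_linear_ad lX) //; exact: bracketLA.
Qed.

(** The Killing form is given as a relation; uniqueness of the trace lets any computation of it
    determine [q]. *)
Lemma killing_unique X Y t : LA X -> LA Y -> is_killing X Y t -> q X Y = - t.
Proof.
move=> lX lY Kt; apply: oppr_inj; rewrite opprK.
by apply: is_trace_unique (lie_linear_adad lX lY) (qK.2 _ _ lX lY) Kt.
Qed.

(** By the Jacobi identity [ad [X, Z]] is the commutator of [ad X] and [ad Z], and the trace of its
    product with [ad X] cancels by cyclicity. *)
Lemma killing_ad X Z m (b : 'I_m -> oper G) : lie_basis b -> LA X -> LA Z ->
  q X (lie_bracket X Z) = 0.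
Proof.
move=> bb lX lZ.
have [MX MXE] := lie_basis_mx bb (fun i => bracketLA lX (bb.1 i)).
have [MZ MZE] := lie_basis_mx bb (fun i => bracketLA lZ (bb.1 i)).
have adad Y W (MY MW : 'M[R]_m) : LA Y ->
    (forall i, lie_bracket Y (b i) = \sum_j MY i j *: b j) ->
    (forall i, lie_bracket W (b i) = \sum_j MW i j *: b j) ->
    forall i, lie_bracket Y (lie_bracket W (b i)) =
      \sum_j (MW *m MY) i j *: b j.
  move=> lY YE WE i; rewrite WE (lie_linear_sum _ (lie_linear_ad lY) bb.1).
  by under eq_bigr do rewrite YE; rewrite comb_mulmx.
pose MW := MZ *m MX - MX *m MZ.
have WE i : lie_bracket (lie_bracket X Z) (b i) = \sum_j MW i j *: b j.
  rewrite (jacobi lX lZ (bb.1 i)) (adad X Z MX MZ) // (adad Z X MZ MX) //.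
  rewrite -sumrB; apply: eq_bigr => j _.
  by rewrite -scalerBl; congr (_ *: _);
    rewrite /MW [RHS]mxE [X in _ = _ + X]mxE.
rewrite (@killing_unique _ _ 0 lX (bracketLA lX lZ)) ?oppr0 //.
exists m, b, (MW *m MX); split=> //; first exact: adad.
by rewrite mulmxBl raddfB /= -!mulmxA [X in _ - X]mxtrace_mulC -mulmxA subrr.
Qed.

(* Koszul: [q (nab X X) Z = - q X (lie_bracket X Z)]. *)
Lemma levi_civita_self nab X m (b : 'I_m -> oper G) :
  lie_basis b -> levi_civita q nab -> LA X -> nab X X = 0.
Proof.
move=> bb [nabLA _ tors compat] lX.
have lXX := nabLA _ _ lX lX; set Z := nab X X in lXX *.
have [qC _ qpos] := qK.1.
have lXZ := nabLA _ _ lX lXX; have lZX := nabLA _ _ lXX lX.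
have q1 : q X (nab Z X) = 0.
  by have := compat Z X X lXX lX lX; rewrite (qC _ _ lZX lX); lra.
have q2 : q X (nab X Z) = 0.
  have -> : nab X Z = 1 *: nab Z X + lie_bracket X Z.
    by rewrite -tors // scale1r addrCA subrr addr0.
  have [_ qlin _] := qK.1.
  rewrite qC //; last by apply: LA_lin => //; exact: bracketLA.
  rewrite qlin //; last exact: bracketLA.
  rewrite (qC _ _ lZX lX) q1 (qC _ _ (bracketLA lX lXX) lX).
  by rewrite (killing_ad bb) // mulr0 addr0.
(* Metric compatibility along [X] for the pair [X], [Z] equates [q Z Z] with [- q X (nab X Z)],
   which has just been shown to vanish. *)
have qZ : q Z Z = 0 by have := compat X X Z lX lX lXX; rewrite q2 addr0.
apply: contrapT => Z0; have := qpos Z lXX Z0.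
by rewrite qZ ltxx.
Qed.

End NegKilling.
End Killing.

(** * The adjoint action and the invariance of the Killing form *)

Section Adjoint.
Variables (R : realType) (n : nat) (G : lieGroupType R n).
Implicit Types (X Y Z W : oper G) (f : G -> R^o) (g : G).
Local Notation LA := (@lie_algebra R n G).

(** Conjugation of the operator [X] by right translations. If [X] differentiates along
    [x * exp (tX)], then [Ad g X] differentiates along [x * g * exp (tX) * g^-1], which is the usual
    adjoint action. *)
Definition Ad g X : oper G := fun f x => X (fun y => f (y * g^-1)%g) (x * g)%g.

Lemma AdK g X : Ad g (Ad g^-1%g X) = X.
Proof.
apply/funext => f; apply/funext => x; rewrite /Ad invgK mulgK.
by congr (X _ x); apply/funext => y; rewrite mulgK.
Qed.

Lemma AdVK g X : Ad g^-1%g (Ad g X) = X.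
Proof. by rewrite -[X in Ad _ (Ad X _)]invgK AdK. Qed.

Lemma Ad_lin g (a : R) X Y : Ad g (a *: X + Y) = a *: Ad g X + Ad g Y.
Proof. by []. Qed.

Lemma Ad0 g : Ad g 0 = 0. Proof. by []. Qed.

Lemma Ad_sum g (I : Type) (r : seq I) (a : I -> R) (b : I -> oper G) :
  Ad g (\sum_(i <- r) a i *: b i) = \sum_(i <- r) a i *: Ad g (b i).
Proof.
elim: r => [|i r IH]; first by rewrite !big_nil Ad0.
by rewrite !big_cons Ad_lin IH.
Qed.

Lemma Ad_bracket g X Y : Ad g (lie_bracket X Y) = lie_bracket (Ad g X) (Ad g Y).
Proof.
have AdM A B : Ad g (A \o B) = Ad g A \o Ad g B.
  apply/funext => f; apply/funext => x; rewrite /Ad /=.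
  by congr (A _ _); apply/funext => y; rewrite mulgVK.
have brE A B : lie_bracket A B = (A \o B) - (B \o A) by [].
by rewrite !brE -!AdM.
Qed.

(** The direction from the translate to [f] shows that [Ad g X] still vanishes on non-smooth
    functions. *)
Lemma smooth_rtranslateP f g : smooth (fun x => f (x * g)%g) <-> smooth f.
Proof.
split=> [sf|]; last exact: smooth_rtranslate.
have := smooth_rtranslate g^-1%g sf.
by congr smooth; apply/funext => x; rewrite mulgVK.
Qed.

(** Right translation preserves smoothness and products, and it commutes with left translation,
    whence left invariance. *)
Lemma LA_Ad g X : LA X -> LA (Ad g X).
Proof.
move=> [vX lX].
have sm f : smooth f -> smooth (fun y => f (y * g^-1)%g).
  by exact: smooth_rtranslate.
split; first split.
- by move=> f sf; apply: smooth_rtranslate; exact: vf_smooth (sm _ sf).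
- move=> f sf; apply/funext => x; rewrite /Ad (vf_notsmooth vX) //.
  by rewrite smooth_rtranslateP.
- move=> a f h sf sh; apply/funext => x.
  by rewrite /Ad (vf_lin vX a (sm _ sf) (sm _ sh)).
- move=> f h sf sh; apply/funext => x.
  have := congr1 (@^~ (x * g)%g) (vfM vX (sm _ sf) (sm _ sh)).
  by rewrite /= !fctE /= mulgK.
- move=> h f sf; apply/funext => x; rewrite /Ad -mulgA.
  have := congr1 (@^~ (x * g)%g) (lX h _ (sm _ sf)) => /= <-.
  by congr (X _ _); apply/funext => y; rewrite mulgA.
Qed.

Lemma lie_basis_Ad g m (b : 'I_m -> oper G) :
  lie_basis b -> lie_basis (fun i => Ad g (b i)).
Proof.
move=> [lb ub]; split=> [i|X lX]; first exact: LA_Ad.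
have [a [aE ua]] := ub _ (LA_Ad g^-1%g lX); exists a; split.
  by rewrite -Ad_sum -aE AdK.
by move=> a' a'E; apply: ua; rewrite a'E -Ad_sum AdVK.
Qed.

(** [Ad g] is an automorphism of the Lie algebra, so the same matrix [A] represents the transported
    map in the transported basis. *)
Lemma is_killing_Ad g X Y t :
  is_killing X Y t -> is_killing (Ad g X) (Ad g Y) t.
Proof.
move=> [m [b [A [bb bA ->]]]]; exists m, (fun i => Ad g (b i)), A.
split=> // [|i]; first exact: lie_basis_Ad.
by rewrite -!Ad_bracket bA Ad_sum.
Qed.

Lemma neg_killing_Ad (q : oper G -> oper G -> R) g X Y :
  neg_killing_metric q ->
  (forall X Y, LA X -> LA Y -> LA (lie_bracket X Y)) ->
  LA X -> LA Y -> q (Ad g X) (Ad g Y) = q X Y.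
Proof.
move=> qK brLA lX lY.
rewrite (killing_unique qK brLA (LA_Ad g lX) (LA_Ad g lY)
  (is_killing_Ad g (qK.2 _ _ lX lY))).
exact: opprK.
Qed.

(** Invariance of [q] gives [U *m U^T = 1]; as [U] is square, the product in the other order is also
    1, and this is the form that the invariance of the Casimir matrix uses. *)
Lemma Ad_orthonormal (q : oper G -> oper G -> R) m (E : 'I_m -> oper G) g :
  neg_killing_metric q ->
  (forall X Y, LA X -> LA Y -> LA (lie_bracket X Y)) ->
  lie_basis E -> (forall i j, q (E i) (E j) = (i == j)%:R) ->
  exists2 U : 'M[R]_m, forall i, Ad g (E i) = \sum_j U i j *: E j &
    U^T *m U = 1%:M.
Proof.
move=> qK brLA bE oE.
have [U UE] := lie_basis_mx bE (fun i => LA_Ad g (bE.1 i)).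
exists U => //; apply: mulmx1C; apply/matrixP => i j.
have [qC qlin _] := qK.1.
have q0 Y : LA Y -> q 0 Y = 0.
  move=> lY; have := qlin 1 0 0 Y (@LA0 R n G) (@LA0 R n G) lY.
  by rewrite scaler0 addr0 mul1r; lra.
have q_sum (a : 'I_m -> R) Y : LA Y ->
    q (\sum_k a k *: E k) Y = \sum_k a k * q (E k) Y.
  move=> lY; elim: (index_enum _) => [|k r IH]; first by rewrite !big_nil q0.
  rewrite !big_cons qlin ?IH //; first exact: bE.1.
  exact: LA_sum bE.1.
rewrite [RHS]mxE -oE -(neg_killing_Ad g qK brLA (bE.1 i) (bE.1 j)) !UE.
rewrite q_sum; last exact: LA_sum bE.1.
rewrite mxE; apply: eq_bigr => k _; rewrite mxE; congr (_ * _).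
rewrite qC; [|exact: bE.1|exact: LA_sum bE.1].
rewrite q_sum; last exact: bE.1.
rewrite (bigD1 k) //= big1 => [|l lk]; first by rewrite oE eqxx mulr1 addr0.
by rewrite oE (negPf lk) mulr0.
Qed.

End Adjoint.

(** * Differentiation of representations and the Casimir matrix *)

Section ComplexDerivation.
Variables (R : realType) (n : nat) (G : lieGroupType R n).
Implicit Types (X Y Z : oper G) (u v : G -> R[i]) (g : G).
Local Notation C := R[i].
Local Notation LA := (@lie_algebra R n G).
Local Notation re u := (fun x => complex.Re (u x) : R^o).
Local Notation im u := (fun x => complex.Im (u x) : R^o).

Definition csmooth u : Prop := smooth (re u) /\ smooth (im u).

Definition cder X u : G -> C := fun x => Complex (X (re u) x) (X (im u) x).

Lemma smoothN (f : G -> R^o) : smooth f -> smooth (fun x => - f x : R^o).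
Proof.
move=> sf; have := smoothZ (-1) sf.
by congr smooth; apply/funext => x; rewrite !fctE /= -[RHS]mulN1r.
Qed.

Lemma csmooth_cst (c : C) : csmooth (fun=> c).
Proof. by split; exact: smooth_cst. Qed.

Lemma csmoothD u v : csmooth u -> csmooth v -> csmooth (fun x => u x + v x).
Proof.
move=> [su1 su2] [sv1 sv2]; split.
- have := smoothD su1 sv1; congr smooth; apply/funext => x.
  by case: (u x) (v x) => [? ?] [].
- have := smoothD su2 sv2; congr smooth; apply/funext => x.
  by case: (u x) (v x) => [? ?] [].
Qed.

Lemma csmoothM u v : csmooth u -> csmooth v -> csmooth (fun x => u x * v x).
Proof.
move=> [su1 su2] [sv1 sv2]; split.
- have := smoothD (smoothM su1 sv1) (smoothN (smoothM su2 sv2)).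
  by congr smooth; apply/funext => x; case: (u x) (v x) => [? ?] [].
- have := smoothD (smoothM su1 sv2) (smoothM su2 sv1).
  by congr smooth; apply/funext => x; case: (u x) (v x) => [? ?] [].
Qed.

Lemma csmoothJ u : csmooth u -> csmooth (fun x => (u x)^*%R).
Proof.
move=> [su1 su2]; split.
- by have := su1; congr smooth; apply/funext => x; case: (u x).
- by have := smoothN su2; congr smooth; apply/funext => x; case: (u x).
Qed.

Lemma csmooth_sum (I : Type) (r : seq I) (F : I -> G -> C) :
  (forall i, csmooth (F i)) -> csmooth (fun x => \sum_(i <- r) F i x).
Proof.
move=> sF; elim: r => [|i r IH].
  by under eq_fun do rewrite big_nil; exact: csmooth_cst.
by under eq_fun do rewrite big_cons; exact: csmoothD.
Qed.

Section VF.
Variables (X : oper G) (vX : vector_field X).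

Lemma cder_smooth u : csmooth u -> csmooth (cder X u).
Proof. by move=> [su1 su2]; split; exact: vf_smooth. Qed.

Lemma cder_cst (c : C) x : cder X (fun=> c) x = 0.
Proof. by rewrite /cder !(vf_cst vX). Qed.

Lemma cderD u v x : csmooth u -> csmooth v ->
  cder X (fun x => u x + v x) x = cder X u x + cder X v x.
Proof.
move=> [su1 su2] [sv1 sv2]; rewrite /cder.
have -> : re (fun x => u x + v x) = re u + re v.
  by apply/funext => y; rewrite !fctE /=; case: (u y) (v y) => [? ?] [].
have -> : im (fun x => u x + v x) = im u + im v.
  by apply/funext => y; rewrite !fctE /=; case: (u y) (v y) => [? ?] [].
by rewrite !(vfD vX).
Qed.

Lemma cderM u v x : csmooth u -> csmooth v ->
  cder X (fun x => u x * v x) x = cder X u x * v x + u x * cder X v x.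
Proof.
move=> [su1 su2] [sv1 sv2]; rewrite /cder.
have -> : re (fun x => u x * v x) = (re u \* re v) - (im u \* im v).
  by apply/funext => y; rewrite !fctE /=; case: (u y) (v y) => [? ?] [].
have -> : im (fun x => u x * v x) = (re u \* im v) + (im u \* re v).
  by apply/funext => y; rewrite !fctE /=; case: (u y) (v y) => [? ?] [].
rewrite (vfB vX (smoothM su1 sv1) (smoothM su2 sv2)).
rewrite (vfD vX (smoothM su1 sv2) (smoothM su2 sv1)).
rewrite !(vfM vX) //.
have cE (z : C) : z = Complex (complex.Re z) (complex.Im z) by case: z.
rewrite [in u x * _](cE (u x)) [in _ * v x](cE (v x)).
apply/eqP; rewrite eq_complex; apply/andP; split; apply/eqP.
  change ((X (re u) x * re v x + re u x * X (re v) x) -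
    (X (im u) x * im v x + im u x * X (im v) x) =
    (X (re u) x * re v x - X (im u) x * im v x) +
    (re u x * X (re v) x - im u x * X (im v) x)).
  ring.
change ((X (re u) x * im v x + re u x * X (im v) x) +
    (X (im u) x * re v x + im u x * X (re v) x) =
    (X (re u) x * im v x + X (im u) x * re v x) +
    (re u x * X (im v) x + im u x * X (re v) x)).
ring.
Qed.

Lemma cderJ u x : csmooth u -> cder X (fun x => (u x)^*%R) x = (cder X u x)^*%R.
Proof.
move=> [su1 su2]; rewrite /cder.
have -> : re (fun x => (u x)^*%R) = re u by apply/funext => y; case: (u y).
have -> : im (fun x => (u x)^*%R) = (-1) *: im u.
  apply/funext => y; change (complex.Im (u y)^*%R = -1 * complex.Im (u y)).
  by rewrite mulN1r; case: (u y).
by rewrite (vfZ vX) // scaleN1r.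
Qed.

Lemma cder_sum (I : Type) (r : seq I) (F : I -> G -> C) x :
  (forall i, csmooth (F i)) ->
  cder X (fun x => \sum_(i <- r) F i x) x = \sum_(i <- r) cder X (F i) x.
Proof.
move=> sF; elim: r => [|i r IH].
  by under eq_fun do rewrite big_nil; rewrite big_nil cder_cst.
under eq_fun do rewrite big_cons; rewrite big_cons cderD ?IH //.
exact: csmooth_sum.
Qed.

End VF.

Lemma cder_ltranslate X u g x : LA X -> csmooth u ->
  cder X (fun y => u (g * y)%g) x = cder X u (g * x)%g.
Proof.
move=> [_ lX] [su1 su2]; rewrite /cder.
by congr Complex; [have := lX g _ su1|have := lX g _ su2] => /(congr1 (@^~ x)).
Qed.

Lemma cder_Ad X u g x :
  cder (Ad g X) u x = cder X (fun y => u (y * g^-1)%g) (x * g)%g.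
Proof. by []. Qed.

Lemma cder_comb m (a : 'I_m -> R) (b : 'I_m -> oper G) u x :
  cder (\sum_i a i *: b i) u x = \sum_i (a i)%:C%C * cder (b i) u x.
Proof.
rewrite /cder !oper_sumE.
elim: (index_enum _) => [|i r IH]; first by rewrite !big_nil.
rewrite !big_cons -IH; apply/eqP; rewrite eq_complex /= !operZE.
by rewrite !mul0r subr0 addr0 !eqxx.
Qed.

End ComplexDerivation.

(** * Derivatives of matrix-valued functions, differentials of representations, and the Casimir
    matrix *)

Section MatrixDerivation.
Variables (R : realType) (n : nat) (G : lieGroupType R n).
Implicit Types (X Y Z : oper G) (g : G).
Local Notation C := R[i].
Local Notation LA := (@lie_algebra R n G).

Definition msmooth p q (M : G -> 'M[C]_(p, q)) : Prop :=
  forall i j, csmooth (fun x => M x i j).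

Definition mder X p q (M : G -> 'M[C]_(p, q)) (x : G) : 'M[C]_(p, q) :=
  \matrix_(i, j) cder X (fun y => M y i j) x.

Lemma msmooth_cst p q (A : 'M[C]_(p, q)) : msmooth (fun=> A).
Proof. by move=> i j; exact: csmooth_cst. Qed.

Lemma msmooth_mulmx p q r (M : G -> 'M[C]_(p, q)) (N : G -> 'M[C]_(q, r)) :
  msmooth M -> msmooth N -> msmooth (fun x => M x *m N x).
Proof.
move=> sM sN i j; under eq_fun do rewrite mxE.
by apply: csmooth_sum => k; exact: csmoothM.
Qed.

Lemma msmooth_adj p q (M : G -> 'M[C]_(p, q)) :
  msmooth M -> msmooth (fun x => (M x)^t*).
Proof. by move=> sM i j; under eq_fun do rewrite !mxE; exact: csmoothJ. Qed.

Lemma msmooth_tens p q r s (M : G -> 'M[C]_(p, q)) (N : G -> 'M[C]_(r, s)) :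
  msmooth M -> msmooth N -> msmooth (fun x => M x *t N x).
Proof. by move=> sM sN i j; under eq_fun do rewrite mxE; exact: csmoothM. Qed.

Section VF.
Variables (X : oper G) (vX : vector_field X).

Lemma mder_cst p q (A : 'M[C]_(p, q)) x : mder X (fun=> A) x = 0.
Proof. by apply/matrixP => i j; rewrite !mxE cder_cst. Qed.

Lemma mder_mulmx p q r (M : G -> 'M[C]_(p, q)) (N : G -> 'M[C]_(q, r)) x :
  msmooth M -> msmooth N ->
  mder X (fun x => M x *m N x) x = mder X M x *m N x + M x *m mder X N x.
Proof.
move=> sM sN; apply/matrixP => i j; rewrite !mxE -big_split /=.
under eq_fun do rewrite mxE.
rewrite cder_sum // => [|k]; last exact: csmoothM.
by apply: eq_bigr => k _; rewrite cderM // !mxE.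
Qed.

Lemma mder_mull p q r (A : 'M[C]_(p, q)) (N : G -> 'M[C]_(q, r)) x :
  msmooth N -> mder X (fun x => A *m N x) x = A *m mder X N x.
Proof.
move=> sN; rewrite (mder_mulmx _ (msmooth_cst A) sN).
by rewrite mder_cst mul0mx add0r.
Qed.

Lemma mder_mulr p q r (A : 'M[C]_(q, r)) (N : G -> 'M[C]_(p, q)) x :
  msmooth N -> mder X (fun x => N x *m A) x = mder X N x *m A.
Proof.
move=> sN; rewrite (mder_mulmx _ sN (msmooth_cst A)).
by rewrite mder_cst mulmx0 addr0.
Qed.

Lemma mder_adj p q (M : G -> 'M[C]_(p, q)) x :
  msmooth M -> mder X (fun x => (M x)^t*) x = (mder X M x)^t*.
Proof.
move=> sM; apply/matrixP => i j; rewrite !mxE.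
by under eq_fun do rewrite !mxE; rewrite cderJ.
Qed.

Lemma mder_tens p q r s (M : G -> 'M[C]_(p, q)) (N : G -> 'M[C]_(r, s)) x :
  msmooth M -> msmooth N ->
  mder X (fun x => M x *t N x) x = mder X M x *t N x + M x *t mder X N x.
Proof.
move=> sM sN; apply/matrixP => i j; rewrite !mxE.
by under eq_fun do rewrite mxE; rewrite cderM.
Qed.

End VF.

Section Representation.
Variables (d : nat) (rho : G -> 'M[C]_d).
Hypotheses (rho_smooth : msmooth rho) (rho1 : rho 1%g = 1%:M)
  (rhoM : forall x y, rho (x * y)%g = rho x *m rho y).

Definition drep X : 'M[C]_d := mder X rho 1%g.

(** By left invariance the derivative at [x] is the derivative at 1 of [rho (x * y)] in [y], and
    [rho x] factors out. *)
Lemma mder_rep X x : LA X -> mder X rho x = rho x *m drep X.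
Proof.
move=> lX; rewrite -(mder_mull (LA_vf lX) _ _ rho_smooth).
apply/matrixP => i j; rewrite !mxE.
transitivity (cder X (fun y => rho (x * y)%g i j) 1%g).
  by have := cder_ltranslate x 1%g lX (rho_smooth i j); rewrite mulg1 => ->.
by congr (cder X _ _); apply/funext => y; rewrite rhoM.
Qed.

Lemma drep_Ad X g : LA X -> drep (Ad g X) = rho g *m drep X *m rho g^-1%g.
Proof.
move=> lX; rewrite -(mder_rep g lX) -(mder_mulr (LA_vf lX) _ _ rho_smooth).
apply/matrixP => i j; rewrite !mxE cder_Ad mul1g.
by congr (cder X _ _); apply/funext => y; rewrite rhoM.
Qed.

Lemma drep_comb m (a : 'I_m -> R) (b : 'I_m -> oper G) :
  drep (\sum_i a i *: b i) = \sum_i (a i)%:C%C *: drep (b i).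
Proof.
apply/matrixP => i j; rewrite summxE mxE cder_comb.
by apply: eq_bigr => k _; rewrite !mxE.
Qed.

(** The identity [rho x *m (rho x)^t* = 1] is differentiated at the unit element. *)
Lemma drep_skew X : LA X -> (forall x, rho x \is unitarymx) ->
  (drep X)^t* = - drep X.
Proof.
move=> lX urho; have vX := LA_vf lX.
have := mder_mulmx vX 1%g rho_smooth (msmooth_adj rho_smooth).
have -> : (fun x => rho x *m (rho x)^t*) = fun=> 1%:M.
  by apply/funext => x; apply/unitarymxP.
rewrite (mder_cst vX) (mder_adj vX) // rho1 trmx1 map_mx1 mulmx1 mul1mx.
by move=> /esym/addr0_eq <-.
Qed.

Variables (m : nat) (E : 'I_m -> oper G).

Definition casimir : 'M[C]_d := \sum_i drep (E i) *m drep (E i).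

(** Conjugation by [rho g] replaces each [E i] by [Ad g (E i)], and a sum of squares is unchanged by
    an orthogonal change of frame. *)
Lemma casimir_comm (g : G) (U : 'M[R]_m) : (forall i, LA (E i)) ->
  (forall i, Ad g (E i) = \sum_j U i j *: E j) -> U^T *m U = 1%:M ->
  comm_mx casimir (rho g).
Proof.
move=> lE UE UU.
suff cas : rho g *m casimir *m rho g^-1%g = casimir.
  rewrite /comm_mx -[in LHS]cas -mulmxA -rhoM mulVg rho1 mulmx1 //.
rewrite /casimir mulmx_sumr mulmx_suml.
have -> : \sum_i rho g *m (drep (E i) *m drep (E i)) *m rho g^-1%g =
    \sum_i drep (Ad g (E i)) *m drep (Ad g (E i)).
  apply: eq_bigr => i _; rewrite drep_Ad // !mulmxA; congr (_ *m _ *m _).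
  by rewrite -!mulmxA -rhoM mulVg rho1 mulmx1.
under eq_bigr do rewrite UE drep_comb.
have UUE j k : \sum_i (U i j)%:C%C * (U i k)%:C%C = (j == k)%:R :> C.
  have /matrixP/(_ j k) := UU; rewrite !mxE => UUjk.
  transitivity ((\sum_i U^T j i * U i k)%:C%C); last by rewrite UUjk; case: eqP.
  by rewrite rmorph_sum; apply: eq_bigr => i _; rewrite mxE rmorphM.
(* After expansion the coefficient of [drep (E j) *m drep (E k)] is the [(j, k)] entry of
   [U^T *m U]. *)
transitivity (\sum_j \sum_k (\sum_i (U i j)%:C%C * (U i k)%:C%C) *:
    (drep (E j) *m drep (E k))).
  under eq_bigr do rewrite mulmx_suml.
  rewrite exchange_big; apply: eq_bigr => j _.
  under eq_bigr do rewrite mulmx_sumr.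
  rewrite exchange_big; apply: eq_bigr => k _.
  rewrite scaler_suml; apply: eq_bigr => i _.
  by rewrite -scalemxAl -scalemxAr scalerA.
apply: eq_bigr => j _; under eq_bigr do rewrite UUE.
rewrite (bigD1 j) //= big1 => [|k kj]; first by rewrite eqxx scale1r addr0.
by rewrite eq_sym (negPf kj) scale0r.
Qed.

Lemma mder_casimir x : (forall i, LA (E i)) ->
  \sum_i mder (E i) (mder (E i) rho) x = rho x *m casimir.
Proof.
move=> lE; rewrite mulmx_sumr; apply: eq_bigr => i _.
have -> : mder (E i) rho = fun x => rho x *m drep (E i).
  by apply/funext => y; rewrite mder_rep.
by rewrite (mder_mulr (LA_vf (lE i))) // mder_rep // mulmxA.
Qed.

End Representation.
End MatrixDerivation.

(** * The Laplacian on matrix coefficients *)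

Section Laplacian.
Variables (R : realType) (n : nat) (G : lieGroupType R n).
Implicit Types (X Y Z : oper G) (g : G).
Local Notation C := R[i].
Local Notation LA := (@lie_algebra R n G).
Local Notation re u := (fun x => complex.Re (u x) : R^o).
Local Notation im u := (fun x => complex.Im (u x) : R^o).

(** This is the order 0 clause of smoothness, read through a chart. It supplies the continuity that
    the record [unitary_irrep] demands of the constituents. *)
Lemma smooth_continuous (f : G -> R^o) : smooth f -> continuous f.
Proof.
move=> sf x; have [phi aphi phix] := @lie_atlas_cover R n G x.
have fc : {for x, continuous ((f \o cinv phi) \o cfun phi)}.
  apply: continuous_comp; first exact: cfun_continuous.
  by apply: (sf _ aphi 0%N); exists x.
have fE : {near x, (f \o cinv phi) \o cfun phi =1 f}.
  apply: filterS (open_nbhs_nbhs (conj (@cdom_open _ _ _ phi) phix)) => y phiy.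
  by rewrite /= cfunK.
apply: (@cvg_trans _ (((f \o cinv phi) \o cfun phi) @ x)).
  by apply: near_eq_cvg.
have fxE : ((f \o cinv phi) \o cfun phi) x = f x by rewrite /= cfunK.
by rewrite -fxE; exact: fc.
Qed.

Lemma csmooth_pairing p q (A : 'M[C]_(p, q)) (M : G -> 'M[C]_(p, q)) :
  msmooth M -> csmooth (fun x => pairing A (M x)).
Proof.
move=> sM; apply: csmooth_sum => i; apply: csmooth_sum => j.
by apply: csmoothM; [exact: csmooth_cst|exact: sM].
Qed.

Lemma msmooth_mder X p q (M : G -> 'M[C]_(p, q)) :
  vector_field X -> msmooth M -> msmooth (mder X M).
Proof.
move=> vX sM i j; under eq_fun do rewrite mxE.
exact: cder_smooth.
Qed.

Lemma cder_pairing X p q (A : 'M[C]_(p, q)) (M : G -> 'M[C]_(p, q)) x :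
  vector_field X -> msmooth M ->
  cder X (fun x => pairing A (M x)) x = pairing A (mder X M x).
Proof.
move=> vX sM; rewrite /pairing.
have sAM i j : csmooth (fun x => A i j * M x i j).
  by apply: csmoothM; [exact: csmooth_cst|exact: sM].
rewrite cder_sum // => [|i]; last exact: csmooth_sum.
apply: eq_bigr => i _; rewrite cder_sum //.
apply: eq_bigr => j _; rewrite cderM //; last exact: csmooth_cst.
by rewrite cder_cst // mul0r add0r mxE.
Qed.

Variables (q : oper G -> oper G -> R) (L : oper G).

(** These are the only facts about the metric and its connection on which the rest relies: the
    Laplacian is a plain sum of squares, and the adjoint action is orthogonal in the frame. *)
Definition casimir_frame m (E : 'I_m -> oper G) : Prop :=
  [/\ forall i, LA (E i),
      forall f, smooth f -> L f = \sum_i E i (E i f) &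
      forall g, exists2 U : 'M[R]_m,
        forall i, Ad g (E i) = \sum_j U i j *: E j & U^T *m U = 1%:M].

Lemma laplace_casimir_frame : neg_killing_metric q -> laplace_beltrami q L ->
  exists m (E : 'I_m -> oper G), casimir_frame E.
Proof.
move=> qK [nab [m [E [lc bE oE LE]]]]; exists m, E.
(* Closure under the bracket is read off from the connection: it preserves left-invariant fields,
   and being torsion-free it expresses the bracket as [nab X Y - nab Y X]. *)
have brLA X Y : LA X -> LA Y -> LA (lie_bracket X Y).
  have [nabLA _ tors _] := lc; move=> lX lY.
  by rewrite -tors //; apply: LAB; exact: nabLA.
split; first exact: bE.1.
- move=> f sf; rewrite LE //; apply: eq_bigr => i _.
  rewrite (levi_civita_self qK brLA bE lc (bE.1 i)).
  exact: subr0.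
- by move=> g; exact: Ad_orthonormal qK brLA bE oE.
Qed.

Variables (m : nat) (E : 'I_m -> oper G).
Hypothesis frE : casimir_frame E.

Lemma laplace_cder u x : csmooth u ->
  Complex (L (re u) x) (L (im u) x) = \sum_i cder (E i) (cder (E i) u) x.
Proof.
have [_ LE _] := frE => -[su1 su2].
rewrite !LE // !fct_sumE.
elim: (index_enum _) => [|i r IH]; first by rewrite !big_nil.
by rewrite !big_cons -IH.
Qed.

Lemma laplace_pairing d (rho : G -> 'M[C]_d) (A : 'M[C]_d) x :
  msmooth rho -> (forall x y, rho (x * y)%g = rho x *m rho y) ->
  let u x := pairing A (rho x) in
  Complex (L (re u) x) (L (im u) x) = pairing A (rho x *m casimir rho E).
Proof.
have [lE _ _] := frE => srho rhoM u.
rewrite laplace_cder; last exact: csmooth_pairing.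
rewrite -mder_casimir // pairing_sumr; apply: eq_bigr => i _.
have vE := LA_vf (lE i).
have -> : cder (E i) u = fun y => pairing A (mder (E i) rho y).
  by apply/funext => y; rewrite /u cder_pairing.
by rewrite cder_pairing //; exact: msmooth_mder.
Qed.

(** The matrix entries of [xi] are themselves coefficients, hence smooth eigenfunctions. This
    upgrades the continuity of [xi] to smoothness, and the eigenvalue equation at the unit element
    gives the Casimir matrix entry by entry. *)
Lemma rep_norm_casimir (xi : unitary_irrep G) r : rep_norm L xi r ->
  [/\ msmooth xi, 0 <= r & casimir xi E = (- (r%:C%C) ^+ 2)%:M].
Proof.
move=> [lam [lam0 sub] ->].
have entry i j : eigenfunction L lam (fun x => pairing (delta_mx i j) (xi x)).
  by apply: sub; exists (delta_mx i j).
have srho : msmooth xi.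
  move=> i j; have [] := entry i j.
  under eq_fun do rewrite pairing_delta.
  move=> su1; under eq_fun do rewrite pairing_delta.
  by move=> su2 _ _; split.
split=> //.
apply/matrixP => i j.
have := @laplace_pairing _ xi (delta_mx i j) 1%g srho (@rmapM _ _ _ xi).
rewrite pairing_delta rmap1 mul1mx /= => <-.
have [_ _ Lre Lim] := entry i j.
have neg (f : G -> R^o) h : - f = lam *: h -> f 1%g = - (lam * h 1%g).
  by move=> fh; rewrite -[LHS]opprK; congr (- _); exact: (congr1 (@^~ 1%g) fh).
rewrite (neg _ _ Lre) (neg _ _ Lim) pairing_delta rmap1.
rewrite -rmorphXn /= sqr_sqrtr // !mxE.
case: eqP => _ /=; apply/eqP;
  by rewrite eq_complex /= ?mulr1 ?mulr0 ?oppr0 !eqxx.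
Qed.

Lemma casimir_rep_norm (xi : unitary_irrep G) r : msmooth xi -> 0 <= r ->
  casimir xi E = (- (r%:C%C) ^+ 2)%:M -> rep_norm L xi r.
Proof.
move=> srho r0 cE; exists (r ^+ 2); last by rewrite sqrtr_sqr ger0_norm.
split; first exact: sqr_ge0.
move=> u [A uE].
have {}uE : u = fun x => pairing A (xi x) by [].
have [su1 su2] : csmooth u by rewrite uE; exact: csmooth_pairing.
have LuE x : Complex (L (re u) x) (L (im u) x) = - (r ^+ 2)%:C%C * u x.
  rewrite uE (@laplace_pairing _ xi A x srho (@rmapM _ _ _ xi)) cE.
  by rewrite mul_mx_scalar pairingZr rmorphXn.
split=> //; apply/funext => x.
- have /(congr1 (@complex.Re R)) /= := LuE x => LuxE.
  change (- L (re u) x = r ^+ 2 * complex.Re (u x)); rewrite LuxE.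
  by case: (u x) => a b /=; rewrite oppr0 mul0r subr0 mulNr opprK.
- have /(congr1 (@complex.Im R)) /= := LuE x => LuxE.
  change (- L (im u) x = r ^+ 2 * complex.Im (u x)); rewrite LuxE.
  by case: (u x) => a b /=; rewrite oppr0 mul0r addr0 mulNr opprK.
Qed.

End Laplacian.

(** * Constituents of a tensor product *)

Section Subrepresentation.
Variables (R : realType) (n : nat) (G : lieGroupType R n).
Local Notation C := R[i].
Variables (N : nat) (rho : G -> 'M[C]_N).
Hypotheses (rho_smooth : msmooth rho) (rho1 : rho 1%g = 1%:M)
  (rhoM : forall x y, rho (x * y)%g = rho x *m rho y)
  (rho_unitary : forall x, rho x \is unitarymx).

Lemma unitary_repV x : rho x^-1%g = (rho x)^t*.
Proof.
have /unitarymxP ux := rho_unitary x.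
by rewrite -[LHS]mulmx1 -ux mulmxA -rhoM mulVg rho1 mul1mx.
Qed.

Variables (d : nat) (B : 'M[C]_(d, N)).
Hypothesis irrB : irreducible_block rho B.
Let xi x := B *m rho x *m B^t*.

Let BB : B *m B^t* = 1%:M.
Proof. by case: irrB => _ /unitarymxP. Qed.

Lemma subrepE x : B *m rho x = xi x *m B.
Proof. by case: irrB => _ uB sB _; exact: unitarymx_stable. Qed.

Lemma subrep_smooth : msmooth xi.
Proof.
apply: msmooth_mulmx; last exact: msmooth_cst.
by apply: msmooth_mulmx => //; exact: msmooth_cst.
Qed.

Lemma subrep1 : xi 1%g = 1%:M. Proof. by rewrite /xi rho1 mulmx1. Qed.

Lemma subrepM x y : xi (x * y)%g = xi x *m xi y.
Proof.
rewrite -[LHS]/(B *m rho (x * y)%g *m B^t*) rhoM mulmxA subrepE -2!mulmxA.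
by congr (_ *m _); exact: mulmxA.
Qed.

Lemma subrep_unitary x : xi x \is unitarymx.
Proof.
apply/unitarymxP; rewrite -[RHS]subrep1 -(mulgV x) subrepM; congr (_ *m _).
by rewrite /xi !trmxC_mul trmxCK unitary_repV mulmxA.
Qed.

Lemma subrep_continuous i j :
  continuous (fun x => complex.Re (xi x i j) : R^o) /\
  continuous (fun x => complex.Im (xi x i j) : R^o).
Proof.
by have [sre sim] := subrep_smooth i j; split; exact: smooth_continuous.
Qed.

Let subrep_dim_gt0 : (0 < d)%N. Proof. by case: irrB. Qed.

Let subrep_irreducible : irreducible_family xi. Proof. by case: irrB. Qed.

Definition subrep : unitary_irrep G :=
  UnitaryIrrep subrep_dim_gt0 subrep1 subrepM subrep_unitary subrep_continuous
    subrep_irreducible.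

Lemma drep_subrep X : lie_algebra X -> drep xi X = B *m drep rho X *m B^t*.
Proof.
move=> /LA_vf vX; have sBrho : msmooth (fun x => B *m rho x).
  by apply: msmooth_mulmx => //; exact: msmooth_cst.
by rewrite /drep /xi (mder_mulr vX) // (mder_mull vX).
Qed.

Lemma drep_subrepE X : lie_algebra X -> B *m drep rho X = drep xi X *m B.
Proof.
move=> /LA_vf vX; rewrite -(mder_mull vX) // -(mder_mulr vX).
  by congr (mder _ _ _); apply/funext => x; exact: subrepE.
exact: subrep_smooth.
Qed.

(** Compression by [B] respects products of matrices that preserve the span of [B], by the
    intertwining relation [drep_subrepE]. *)
Lemma casimir_subrep m (E : 'I_m -> oper G) : (forall i, lie_algebra (E i)) ->
  casimir xi E = B *m casimir rho E *m B^t*.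
Proof.
move=> lE; rewrite /casimir mulmx_sumr mulmx_suml; apply: eq_bigr => i _.
rewrite mulmxA drep_subrepE // -!mulmxA; congr (_ *m _).
by rewrite mulmxA drep_subrep.
Qed.

(** Schur's lemma makes the Casimir matrix of the constituent a scalar [c], and [r] is the square
    root of [- c]. The unit vector [w] of the subspace witnesses the same value in the ambient
    representation, where the triangle inequality is applied. *)
Lemma subrep_norm (L : oper G) m (E : 'I_m -> oper G) : casimir_frame L E ->
  exists r (w : 'rV[C]_N), [/\ rep_norm L subrep r, 0 <= r, w *m w^t* = 1%:M &
    (w *m casimir rho E *m w^t*) 0 0 = - (r%:C%C) ^+ 2].
Proof.
move=> frE; have [lE LE UE] := frE; have [d0 _ _ irr] := irrB.
have [c cE] : exists c, casimir xi E = c%:M.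
  apply: (irreducible_family_scalar d0 irr) => x; have [U UxE UU] := UE x.
  have := casimir_comm subrep_smooth subrep1 subrepM lE UxE UU; exact.
(* The first basis vector, available since [d] is positive; [v *m B] is then the first row of
   [B]. *)
pose v : 'rV[C]_d := delta_mx 0 (Ordinal d0).
have vv : v *m v^t* = 1%:M.
  apply/matrixP => i j; rewrite !ord1 mxE (bigD1 (Ordinal d0)) //= big1.
    by rewrite !mxE !eqxx /= mul1r conjC1 addr0.
  by move=> k k0; rewrite mxE (negPf k0) mul0r.
pose w := v *m B.
have ww : w *m w^t* = 1%:M by rewrite trmxC_mul mulmxA -(mulmxA v) BB mulmx1.
have wcw : w *m casimir rho E *m w^t* = c%:M.
  rewrite trmxC_mul /w -!mulmxA (mulmxA B) (mulmxA _ _ (v^t*)).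
  by rewrite -casimir_subrep // cE mul_scalar_mx -scalemxAr vv scalemx1.
(* The value at a unit vector of minus a sum of squares of skew-Hermitian matrices. The order on
   complex numbers makes [- c] real as well, so that [r] may be defined from its real part. *)
have c_le0 : 0 <= - c.
  have := skew_quadratic_le0 w
    (fun i => drep_skew rho_smooth rho1 (lE i) rho_unitary).
  by rewrite -/(casimir rho E) wcw mxE mulr1n.
pose r := Num.sqrt (complex.Re (- c)).
have rE : (r%:C%C) ^+ 2 = - c.
  rewrite -rmorphXn sqr_sqrtr /=; first by apply: RRe_real; exact: ger0_real.
  by move: c_le0; rewrite lecE => /andP[].
exists r, w; split=> //; [|exact: sqrtr_ge0|].
  apply: (@casimir_rep_norm _ _ _ _ _ _ frE subrep r subrep_smooth).
    exact: sqrtr_ge0.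
  by rewrite rE opprK.
by rewrite wcw rE opprK mxE mulr1n.
Qed.

(** The intertwining relation turns [B^t* *m B *m rho x] into the compressed representation between
    [B^t*] and [B], and these two factors are absorbed into [A]. *)
Lemma subrep_matrix_coefs (A : 'M[C]_N) :
  matrix_coefs subrep (fun x => pairing A (B^t* *m B *m rho x)).
Proof.
exists ((B^t*)^T *m A *m B^T); apply/funext => x.
by rewrite -mulmxA subrepE mulmxA pairing_conj.
Qed.

End Subrepresentation.

(** * Sums of coefficient spaces, and products of matrix coefficients *)

Section SumMatrixCoefs.
Variables (R : realType) (n : nat) (G : lieGroupType R n).
Variable S : set (unitary_irrep G).

Lemma sum_matrix_coefs0 : sum_matrix_coefs S (fun=> 0).
Proof.
(* The empty sum: the representations are indexed by the empty type, so none has to be exhibited. *)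
exists 0%N, (fun i : 'I_0 => False_rect _ (notF (ltn_ord i))), (fun=> fun=> 0).
by split=> [[]|] //; apply/funext => x; rewrite big_ord0.
Qed.

Lemma sum_matrix_coefs_add xi u v : S xi -> matrix_coefs xi u ->
  sum_matrix_coefs S v -> sum_matrix_coefs S (fun x => u x + v x).
Proof.
move=> Sxi xiu [m [eta [w [Sw ->]]]].
exists m.+1, (fun k => oapp eta xi (unlift ord0 k)),
  (fun k => oapp w u (unlift ord0 k)).
split=> [k|]; first by case: unliftP => [j _|_] /=.
apply/funext => x; rewrite big_ord_recl unlift_none /=; congr (_ + _).
by apply: eq_bigr => k _; rewrite liftK.
Qed.

Lemma sum_matrix_coefs_seq (I : eqType) (r : seq I) (F : I -> G -> R[i]) :
  {in r, forall i, exists2 xi, S xi & matrix_coefs xi (F i)} ->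
  sum_matrix_coefs S (fun x => \sum_(i <- r) F i x).
Proof.
elim: r => [|i r IH] SF.
  by under eq_fun do rewrite big_nil; exact: sum_matrix_coefs0.
under eq_fun do rewrite big_cons.
have [xi Sxi xiF] := SF i (mem_head _ _).
apply: (sum_matrix_coefs_add Sxi xiF); apply: IH => j jr.
by apply: SF; rewrite inE jr orbT.
Qed.

End SumMatrixCoefs.

Theorem corollary2p3p1 (R : realType) (n : nat) (G : lieGroupType R n) :
  compact [set: G] -> simply_connected R G -> semisimple G ->
  exists2 c : R, 0 < c <= 1 &
  forall G' : lieGroupType R n,
    compact [set: G'] -> simply_connected R G' -> semisimple G' ->
    lie_algebra_isomorphic G G' ->
  forall (q : oper G' -> oper G' -> R) (L : oper G'),
    neg_killing_metric q -> laplace_beltrami q L ->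
  forall (xi1 xi2 : unitary_irrep G') (r1 r2 : R),
    rep_norm L xi1 r1 -> rep_norm L xi2 r2 ->
  forall u1 u2 : G' -> R[i],
    matrix_coefs xi1 u1 -> matrix_coefs xi2 u2 ->
    sum_matrix_coefs
      [set xi | exists2 r : R, rep_norm L xi r & c * `|r1 - r2| <= r <= r1 + r2]
      (fun x => u1 x * u2 x).
Proof.
move=> _ _ _; exists 1; first by rewrite ltr01 lexx.
move=> G' _ _ _ _ q L qK LB xi1 xi2 r1 r2 n1 n2 u1 u2 [A1 u1E] [A2 u2E].
have [m [E frE]] := laplace_casimir_frame qK LB.
have [lE _ _] := frE.
have [s1 r1_ge0 cas1] := rep_norm_casimir frE n1.
have [s2 r2_ge0 cas2] := rep_norm_casimir frE n2.
pose rho x := xi1 x *t xi2 x.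
have rho_smooth : msmooth rho by exact: msmooth_tens.
have rho1 : rho 1%g = 1%:M by rewrite /rho !rmap1 tensmx11.
have rhoM x y : rho (x * y)%g = rho x *m rho y.
  by rewrite /rho !rmapM tensmx_mul.
have rho_unitary x : rho x \is unitarymx.
  apply/unitarymxP; rewrite /rho trmx_tens map_mxT tensmx_mul.
  have /unitarymxP -> := rmap_unitary xi1 x.
  by have /unitarymxP -> := rmap_unitary xi2 x; rewrite tensmx11.
(* The family is closed under adjoints because the adjoint of [rho x] is [rho x^-1]. *)
have [x|s [sP sE]] := @unitary_decomposition _ _ _ rho.
  by exists x^-1%g; exact: unitary_repV.
(* The product is a coefficient of the tensor product, with coefficient matrix [A1 *t A2]; inserting
   the resolution of the identity splits it over the constituents. *)
have -> : (fun x => u1 x * u2 x) = fun x => \sum_(B <- s)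
    pairing (A1 *t A2) ((tagged B)^t* *m tagged B *m rho x).
  apply/funext => x; rewrite -pairing_sumr -mulmx_suml sE mul1mx u1E u2E.
  exact: pairing_tens.
apply: sum_matrix_coefs_seq => B /sP irrB.
pose xi := subrep rho_smooth rho1 rhoM rho_unitary irrB.
exists xi; last exact: subrep_matrix_coefs.
have [r [w [nr r_ge0 ww wcw]]] :=
  subrep_norm rho_smooth rho1 rhoM rho_unitary irrB frE.
exists r => //; rewrite mul1r.
(* The Leibniz rule at the unit element, where both representations are the identity, writes the
   differential of the tensor product as [D1 i + D2 i]. *)
pose D1 i := drep xi1 (E i) *t (1%:M : 'M[R[i]]_(rdim xi2)).
pose D2 i := (1%:M : 'M[R[i]]_(rdim xi1)) *t drep xi2 (E i).
have drhoE i : drep rho (E i) = D1 i + D2 i.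
  by rewrite /drep (mder_tens (LA_vf (lE i))) // !rmap1.
have skD1 i : (D1 i)^t* = - D1 i.
  rewrite /D1 trmx_tens map_mxT trmx1 map_mx1.
  rewrite (drep_skew s1 (rmap1 xi1) (lE i) (rmap_unitary xi1)).
  by apply/matrixP => j k; rewrite !mxE mulNr.
have skD2 i : (D2 i)^t* = - D2 i.
  rewrite /D2 trmx_tens map_mxT trmx1 map_mx1.
  rewrite (drep_skew s2 (rmap1 xi2) (lE i) (rmap_unitary xi2)).
  by apply/matrixP => j k; rewrite !mxE mulrN.
have D1E : \sum_i D1 i *m D1 i = (- (r1%:C%C) ^+ 2)%:M.
  rewrite -tens_scalarl -cas1 tensmx_suml.
  by apply: eq_bigr => i _; rewrite tensmx_mul mulmx1.
have D2E : \sum_i D2 i *m D2 i = (- (r2%:C%C) ^+ 2)%:M.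
  rewrite -tens_scalarr -cas2 tensmx_sumr.
  by apply: eq_bigr => i _; rewrite tensmx_mul mulmx1.
(* The first inequality is the upper bound; the other two together bound the absolute difference of
   [r1] and [r2] by [r]. *)
have [||||rle r1le r2le] := @skew_triangle _ _ _ D1 D2 w r1%:C%C r2%:C%C r%:C%C
    skD1 skD2 _ _ _ ww D1E D2E.
- by rewrite ler0c.
- by rewrite ler0c.
- by rewrite ler0c.
- by rewrite -wcw; under eq_bigr do rewrite -drhoE.
move: rle r1le r2le; rewrite -!rmorphD !lecR => rle r1le r2le.
by rewrite rle andbT ler_norml; apply/andP; split; lra.
Qed.
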